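(* Let $2\le r\le\infty$. Any two representations of $\mathbb{Z}^2$ in $\mathcal{D}^r_+[0,1]$ can be connected by a continuous path of representations of $\mathbb{Z}^2$ in $\mathcal{D}^1_+[0,1]$. That is, for any $(f,g),(f',g')\in\mathcal{R}^r$ there exists a continuous map $\gamma\colon[0,1]\to\mathcal{R}^1$ with $\gamma(0)=(f,g)$ and $\gamma(1)=(f',g')$.
   Context: For $1\le r\le\infty$ ($r$ an integer or $\infty$), $\mathcal{D}^r_+[0,1]$ is the group of orientation-preserving $\mathcal{C}^r$ diffeomorphisms of $[0,1]$, with the usual $\mathcal{C}^r$ topology. A representation of $\mathbb{Z}^2$ in $\mathcal{D}^r_+[0,1]$ (a group homomorphism $\mathbb{Z}^2\to\mathcal{D}^r_+[0,1]$) is identified with a pair of commuting diffeomorphisms, and the space of representations is $$\mathcal{R}^r=\{(f,g)\in(\mathcal{D}^r_+[0,1])^2 \mid f\circ g=g\circ f\}\subset(\mathcal{D}^r_+[0,1])^2$$ with the induced topology. In particular $\mathcal{R}^1$ carries the topology induced by the $\mathcal{C}^1$ topology, and $\mathcal{R}^r\subset\mathcal{R}^1$. *)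

(* Defs.v *)
From mathcomp Require Import all_boot all_order all_algebra.
From mathcomp Require Import all_classical all_reals all_analysis.

Set Implicit Arguments.
Unset Strict Implicit.
Unset Printing Implicit Defensive.

Import Order.TTheory GRing.Theory Num.Theory.
Import numFieldNormedType.Exports.
Local Open Scope classical_set_scope.
Local Open Scope ring_scope.

(* Orders of differentiability: [Some n] is the integer n, [None] is infinity. *)
Definition order_le (k : nat) (r : option nat) : bool :=
  if r is Some n then (k <= n)%N else true.

(* A [set_type] carries the induced topology. *)
Definition I01 (R : realType) : topologicalType :=
  set_type (`[0, 1]%classic : set R).

Definition I01_val (R : realType) (x : I01 R) : R := sval x.

Lemma I01_0_subproof (R : realType) : (0 : R) \in (`[0, 1]%classic : set R).
Proof. by rewrite inE /= in_itv /= lexx ler01. Qed.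

Lemma I01_1_subproof (R : realType) : (1 : R) \in (`[0, 1]%classic : set R).
Proof. by rewrite inE /= in_itv /= lexx ler01. Qed.

Definition I01_0 (R : realType) : I01 R := SigSub (I01_0_subproof R).
Definition I01_1 (R : realType) : I01 R := SigSub (I01_1_subproof R).

Definition diff_quotient (R : realType) (u : I01 R -> R) (x y : I01 R) : R :=
  (u y - u x) / (I01_val y - I01_val x).

(* The filter x^' consists of punctured neighbourhoods within [0, 1], so these
   are one-sided derivatives at the endpoints. *)
Definition derivable01 (R : realType) (u : I01 R -> R) (x : I01 R) : Prop :=
  cvg (diff_quotient u x y @[y --> x^']).

Definition deriv01 (R : realType) (u : I01 R -> R) (x : I01 R) : R :=
  lim (diff_quotient u x y @[y --> x^']).

Definition derivn01 (R : realType) (k : nat) (u : I01 R -> R) : I01 R -> R :=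
  iter k (@deriv01 R) u.

Definition class_C (R : realType) (r : option nat) (u : I01 R -> R) : Prop :=
  (forall k, order_le k.+1 r -> forall x, derivable01 (derivn01 k u) x) /\
  (forall k, order_le k r -> continuous (derivn01 k u)).

Definition diffeo_set (R : realType) (r : option nat) :
    set (I01 R -> I01 R) :=
  [set f | (exists g : I01 R -> I01 R,
              [/\ cancel f g, cancel g f,
                  class_C r (@I01_val R \o f) & class_C r (@I01_val R \o g)]) /\
           {homo f : x y / I01_val x < I01_val y}].

Definition jet (R : realType) (r : option nat) (f : @diffeo_set R r) :
    prod_topology (fun _ : {k : nat | order_le k r} => {uniform I01 R -> R}) :=
  fun k => derivn01 (sval k) (@I01_val R \o sval f).

(* The C^r topology: uniform convergence of all derivatives of order at most r
   (for r infinite, of each of the derivatives). *)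
Definition Diffeo (R : realType) (r : option nat) : topologicalType :=
  initial_topology (@jet R r).

Definition Diffeo_fun (R : realType) (r : option nat) (f : Diffeo R r) :
  I01 R -> I01 R := sval f.

Definition commuting_pairs (R : realType) (r : option nat) :
    set (Diffeo R r * Diffeo R r) :=
  [set fg | Diffeo_fun fg.1 \o Diffeo_fun fg.2 =
            Diffeo_fun fg.2 \o Diffeo_fun fg.1].

Definition Reps (R : realType) (r : option nat) : topologicalType :=
  set_type (@commuting_pairs R r).

(* Forgets the order of differentiability, so that points of different spaces
   [Reps R r] can be compared. *)
Definition Reps_maps (R : realType) (r : option nat) (rho : Reps R r) :
    (I01 R -> I01 R) * (I01 R -> I01 R) :=
  (Diffeo_fun (sval rho).1, Diffeo_fun (sval rho).2).

(* Main.v *)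
Require Import Defs.
From mathcomp Require Import all_boot all_order all_algebra.
From mathcomp Require Import all_classical all_reals all_analysis.
From mathcomp Require Import lra.

(** Each commuting pair (f, g) of C^1 diffeomorphisms is joined to the pair
    (id, id) through commuting pairs, essentially by conjugation.  Diffeomorphisms
    of [0, 1] are first extended to C^1 diffeomorphisms of the line, affinely
    outside [0, 1].  Size is measured by the supremum of |log f'| and |log g'| on
    [0, 1]; a pair of small size is C^1-close to the identity.

    The multipliers, that is, the values of f' at the fixed points of f and of g'
    at those of g, are invariant under C^1 conjugation, and they are the only
    obstruction to making the size small.  Indeed orbits in [0, 1] are monotone,
    so they spend a bounded time away from the fixed points; hence if all
    multipliers satisfy |log| <= eta0 < eta, then |log (f^n)'| <= n eta for some n
    (log_derive_iter).  Let phi be the normalized sum of the c^-i f^i for i < n.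
    With c = exp eta, conjugation by phi makes f' <= exp eta
    (geometric_average_conj), and with c = exp (- eta) it makes
    f' >= exp (- eta).  The derivative of the conjugate of g is a weighted mean of
    values of g', because g commutes with f, so bounds on g' are kept.  Conjugating
    by (1 - t) id + t phi gives a path, along which the bounds persist since the
    derivatives are mediants of those at both ends (joined_conj).

    To lower a multiplier one uses a singular conjugation.  If a is fixed by f and
    g, conjugating by x |-> sg(x - a) |x - a|^s raises both multipliers at a to
    the power s.  The conjugates are still C^1, with derivative
    f'(x) ((f x - a) / (x - a))^(s - 1) in the source variable, and letting s vary
    gives a path along which the size is at most doubled (joined_power).  Only
    finitely many points have to be treated: between two fixed points of f the
    derivative takes the value 1, so fixed points with |log| of the multiplier
    above a given level are isolated uniformly.  A fixed point of f of this kind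
    is also fixed by g, since otherwise its g-orbit would consist of infinitely
    many such points (hyperbolic_common_fixed).

    Combining both devices, a pair of size M is joined to a pair of size M / 2
    through pairs of size at most 4 M (halve_log_bound).  Concatenating infinitely
    many such paths, with M tending to 0, gives a path that converges to the
    identity in the C^1 topology (joined_limit). *)

Set Implicit Arguments.
Unset Strict Implicit.
Unset Printing Implicit Defensive.

Import Order.TTheory GRing.Theory Num.Theory.
Import numFieldNormedType.Exports.
Local Open Scope classical_set_scope.
Local Open Scope ring_scope.

(* In ring_scope, the notation of derive1 is taken by formal derivatives of
   polynomials. *)
Local Notation der := derive1.

(** * The group of C^1 diffeomorphisms of the line fixing 0 and 1 *)

Section C1Diffeomorphisms.
Context {R : realType}.
Implicit Types (f g h : R -> R) (x y : R).

(** Diffeomorphisms of [0, 1] are handled through C^1 extensions to the whole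
    line: derivatives become two-sided, and conjugating maps need not be treated
    separately at the endpoints.  Everything is nevertheless measured on [0, 1]
    only. *)
Record c1diff f : Prop := C1diff {
  c1_derivable : forall x, derivable f x 1;
  c1_continuous_derive : continuous (der f);
  c1_derive_gt0 : forall x, 0 < der f x;
  c1_fix0 : f 0 = 0;
  c1_fix1 : f 1 = 1;
  c1_surj : forall y, exists x, f x = y }.

Lemma is_derive1_derive1 f x d : is_derive x 1 f d -> der f x = d.
Proof. by move=> df; rewrite derive1E; apply: derive_val. Qed.

Lemma c1diff_of_is_derive f df : (forall x, is_derive x 1 f (df x)) ->
    continuous df -> (forall x, 0 < df x) -> f 0 = 0 -> f 1 = 1 ->
    (forall y, exists x, f x = y) ->
  c1diff f /\ der f = df.
Proof.
move=> fd cdf df0 f0 f1 fs.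
have e : der f = df by apply/funext => x; exact: is_derive1_derive1.
by split=> //; split=> //; rewrite e.
Qed.

Lemma c1_is_derive f x : c1diff f -> is_derive x 1 f (der f x).
Proof. by move=> cf; rewrite derive1E; apply: derivableP; apply: c1_derivable. Qed.

Lemma c1_continuous f : c1diff f -> continuous f.
Proof.
move=> cf x; apply/differentiable_continuous/derivable1_diffP.
exact: c1_derivable.
Qed.

Lemma c1_mvt f x y : c1diff f -> x <= y ->
  exists2 z, x <= z <= y & f y - f x = der f z * (y - x).
Proof.
move=> cf xy.
have [z zxy e] : exists2 z, z \in `[x, y]%R & f y - f x = der f z * (y - x).
  apply: MVT_segment => // [z _|]; first exact: c1_is_derive.
  exact/continuous_subspaceT/c1_continuous.
by exists z => //; move: zxy; rewrite in_itv.
Qed.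

Lemma c1_mono f : c1diff f -> {mono f : x y / x < y}.
Proof.
move=> cf; apply: leW_mono; apply: le_mono => x y xy.
have [z _ e] := c1_mvt cf (ltW xy).
by rewrite -subr_gt0 e mulr_gt0 ?subr_gt0 ?c1_derive_gt0.
Qed.

Lemma c1_mono_le f : c1diff f -> {mono f : x y / x <= y}.
Proof. by move=> cf x y; rewrite !leNgt c1_mono. Qed.

Lemma c1_inj f : c1diff f -> injective f.
Proof. by move=> cf x y e; apply/le_anti; rewrite -(c1_mono_le cf) -[X in _ && X](c1_mono_le cf) e lexx. Qed.

Lemma c1_01 f x : c1diff f -> 0 <= x <= 1 -> 0 <= f x <= 1.
Proof.
move=> cf; rewrite -{2}(c1_fix0 cf) -{2}(c1_fix1 cf).
by rewrite !(c1_mono_le cf).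
Qed.

Lemma c1diff_id : c1diff idfun /\ der (idfun : R -> R) = cst 1.
Proof.
apply: c1diff_of_is_derive => // [x|y]; last by exists y.
exact: cvg_cst.
Qed.

Lemma c1diff_comp f g : c1diff f -> c1diff g ->
  c1diff (f \o g) /\ der (f \o g) = (fun x => der f (g x) * der g x).
Proof.
move=> cf cg; apply: c1diff_of_is_derive.
- by move=> x; apply: is_derive1_comp; apply: c1_is_derive.
- move=> x; apply: cvgM; last exact: c1_continuous_derive.
  by apply: continuous_comp; [exact: c1_continuous|exact: c1_continuous_derive].
- by move=> x; rewrite mulr_gt0 // c1_derive_gt0.
- by rewrite /= (c1_fix0 cg) c1_fix0.
- by rewrite /= (c1_fix1 cg) c1_fix1.
- move=> y; have [x <-] := c1_surj cf y; have [z <-] := c1_surj cg x.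
  by exists z.
Qed.

Lemma c1diff_inverse f g : c1diff f -> cancel f g -> cancel g f ->
  c1diff g /\ der g = (fun y => (der f (g y))^-1).
Proof.
move=> cf fK gK.
have cg : continuous g.
  move=> y; have : {near f (g y), continuous g}.
    apply: near_can_continuous; near=> z; first exact: fK.
    exact: (c1_continuous cf).
  by rewrite gK; apply: nbhs_singleton.
apply: c1diff_of_is_derive.
- move=> y; rewrite -{1}(gK y); apply: is_derive_inverse.
  + by near=> z; exact: fK.
  + by near=> z; exact: (c1_continuous cf).
  + exact: c1_is_derive.
  + by rewrite gt_eqF // c1_derive_gt0.
- move=> y; apply: cvgV; first by rewrite gt_eqF // c1_derive_gt0.
  by apply: continuous_comp; [exact: cg|exact: c1_continuous_derive].
- by move=> y; rewrite invr_gt0 c1_derive_gt0.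
- by rewrite -{1}(c1_fix0 cf) fK.
- by rewrite -{1}(c1_fix1 cf) fK.
- by move=> x; exists (f x).
Unshelve. all: by end_near. Qed.

Lemma c1_inverse f : c1diff f -> exists2 g, cancel f g & cancel g f.
Proof.
move=> cf; have [g gK] := choice (c1_surj cf).
by exists g => // x; apply: (c1_inj cf); rewrite gK.
Qed.

Lemma c1diff_iter f n : c1diff f -> c1diff (iter n f).
Proof.
move=> cf; elim: n => [|n IHn]; first exact: (proj1 c1diff_id).
exact: (proj1 (c1diff_comp cf IHn)).
Qed.

End C1Diffeomorphisms.

(** * Uniform convergence on the unit interval *)

Section UniformContinuity.
Context {R : realType}.
Implicit Types (h : R -> R -> R) (f : R -> R).

(** Continuity at t0 of the curve t |-> h t for the topology of uniform
    convergence on [0, 1]. *)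
Definition unif_at h (t0 : R) := forall e, 0 < e ->
  \forall t \near t0, forall x, 0 <= x <= 1 -> `|h t x - h t0 x| < e.

(** Joint continuity suffices because [0, 1] is compact. *)
Lemma joint_unif_at h t0 :
    (forall x, 0 <= x <= 1 -> {for (t0, x), continuous (fun p => h p.1 p.2)}) ->
  unif_at h t0.
Proof.
move=> ch e e0.
have /compact_near_coveringP/near_covering_withinP cov := @segment_compact R 0 1.
have : \forall t \near t0, `[0, 1] `<=` (fun x => `|h t x - h t0 x| < e).
  apply: (cov R (nbhs t0) (fun t x => `|h t x - h t0 x| < e)) => x.
  rewrite /= in_itv /= => x01.
  have /cvgrPdist_lt /(_ (e / 2)) := ch x x01.
  rewrite divr_gt0 // => /(_ isT) [[U V] /= [Ut Vx] UV].
  exists (V, U) => //= -[x' t] [/= Vx' Ut'] _.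
  have h1 := UV (t, x') (conj Ut' Vx').
  have h2 := UV (t0, x') (conj (nbhs_singleton Ut) Vx').
  rewrite (splitr e) -(subrKA (h t0 x)) (le_lt_trans (ler_normD _ _)) //.
  by rewrite ltrD // distrC.
by apply: filterS => t ht x x01; apply: ht; rewrite /= in_itv.
Qed.

Lemma unif_continuous01 f e : continuous f -> 0 < e ->
  exists2 d, 0 < d & forall x y, 0 <= x <= 1 -> `|y - x| < d -> `|f y - f x| < e.
Proof.
move=> cf e0.
have /(_ _ e0) : unif_at (fun t x => f (x + t)) 0.
  apply: joint_unif_at => x _; apply: continuous_comp; last exact: cf.
  by apply: cvgD; [exact: cvg_snd|exact: cvg_fst].
move=> /nbhs_ballP [d /= d0 hd]; exists d => // x y x01 yx.
have := hd (y - x) _ x x01; rewrite addr0 subrKC; apply.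
by rewrite /ball /= sub0r normrN.
Qed.

Lemma continuous01_bounded f : continuous f ->
  exists2 M, 0 < M & forall x, 0 <= x <= 1 -> `|f x| <= M.
Proof.
move=> cf; have [|c _ hc] := @EVT_max R (fun x => `|f x|) 0 1 ler01.
  apply: continuous_subspaceT => x; apply: continuous_comp; first exact: cf.
  exact: norm_continuous.
exists (`|f c| + 1) => [|x x01]; first by rewrite ltr_pwDr.
by rewrite (le_trans (hc x _)) ?in_itv // lerDl.
Qed.

Lemma unif_at_comp h (k : R -> R) t0 :
  {for t0, continuous k} -> unif_at h (k t0) -> unif_at (h \o k) t0.
Proof. by move=> ck hh e e0; exact: (ck _ (hh e e0)). Qed.

Lemma unif_at_glue (h1 h2 : R -> R -> R) c t0 :
    (t0 <= c -> unif_at h1 t0) -> (c <= t0 -> unif_at h2 t0) -> h1 c = h2 c ->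
  unif_at (fun t => if t <= c then h1 t else h2 t) t0.
Proof.
move=> u1 u2 e12 e e0 /=.
have [t0c|ct0|t0c] := ltgtP t0 c.
- near=> t => x x01; rewrite ifT; last by apply: ltW; near: t; exact: lt_nbhsl.
  by move: x x01; near: t; apply: u1 => //; exact: ltW.
- near=> t => x x01; rewrite leNgt ifF; last first.
    by apply/negbF; near: t; exact: lt_nbhsr.
  by move: x x01; near: t; apply: u2 => //; exact: ltW.
- near=> t => x x01; case: ifP => _.
    by move: x x01; near: t; apply: u1 => //; rewrite t0c.
  rewrite t0c e12 -t0c.
  by move: x x01; near: t; apply: u2 => //; rewrite t0c.
Unshelve. all: by end_near. Qed.

End UniformContinuity.

(** * Paths of commuting families in the C^1 topology *)

Section Paths.
Context {R : realType}.
Implicit Types (f : R -> R) (rho : bool -> R -> R) (M : R).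

(** Continuity at t0 of a curve of functions for the C^1 topology on [0, 1]. *)
Definition c1path_at (u : R -> R -> R) (t0 : R) :=
  unif_at u t0 /\ unif_at (fun t => der (u t)) t0.

Definition commuting rho := (forall b, c1diff (rho b)) /\
  forall b b' x, rho b (rho b' x) = rho b' (rho b x).

(** The size of f as a C^1 perturbation of the identity: together with f 0 = 0,
    a bound on the logarithm of the derivative controls both f and f'
    (see log_bound_id), and it is well adapted to conjugation. *)
Definition log_bound M f := forall x, 0 <= x <= 1 -> `|ln (der f x)| <= M.

(** Paths are parametrized by the line and constant outside [0, 1], which makes
    gluing and reparametrization painless. *)
Definition is_path (gamma : R -> bool -> R -> R) rho rho' := [/\
  forall t, t <= 0 -> gamma t = rho,
  forall t, 1 <= t -> gamma t = rho',
  forall t, commuting (gamma t) &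
  forall b t0, c1path_at (fun t => gamma t b) t0].

(** The bound M is recorded along the whole path: this is what makes infinitely
    many paths with M tending to 0 concatenate to a path ending at the
    identity. *)
Definition joined M rho rho' := exists2 gamma, is_path gamma rho rho' &
  forall t b, log_bound M (gamma t b).

Lemma unif_at_near_eq (h h' : R -> R -> R) t0 :
  (\forall t \near t0, h' t = h t) -> unif_at h t0 -> unif_at h' t0.
Proof.
move=> hh' uh e e0; near=> t.
rewrite (nbhs_singleton hh') (_ : h' t = h t); last by near: t.
by near: t; exact: uh.
Unshelve. all: by end_near. Qed.

Lemma c1path_at_near_eq (u u' : R -> R -> R) t0 :
  (\forall t \near t0, u' t = u t) -> c1path_at u t0 -> c1path_at u' t0.
Proof.
move=> uu' [cu cdu]; split; first exact: (unif_at_near_eq uu' cu).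
by apply: (unif_at_near_eq _ cdu); near=> t; congr der; near: t.
Unshelve. all: by end_near.
Qed.

Lemma c1path_at_glue (u1 u2 : R -> R -> R) c t0 :
    (t0 <= c -> c1path_at u1 t0) -> (c <= t0 -> c1path_at u2 t0) ->
    u1 c = u2 c ->
  c1path_at (fun t => if t <= c then u1 t else u2 t) t0.
Proof.
move=> h1 h2 e; split.
  by apply: unif_at_glue => // t0c; [case: (h1 t0c)|case: (h2 t0c)].
under eq_fun do rewrite fun_if.
by apply: unif_at_glue => [t0c|t0c|]; [case: (h1 t0c)|case: (h2 t0c)|rewrite e].
Qed.

Lemma c1path_at_comp (u : R -> R -> R) (k : R -> R) t0 :
  {for t0, continuous k} -> c1path_at u (k t0) -> c1path_at (u \o k) t0.
Proof.
by move=> ck [cu cdu]; split;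
  [exact: unif_at_comp cu|exact: (unif_at_comp ck cdu)].
Qed.

Lemma c1path_at_cst f t0 : c1path_at (fun=> f) t0.
Proof.
by split=> e e0; near=> t => x _; rewrite subrr normr0.
Unshelve. all: by end_near. Qed.

Lemma joined_refl M rho : commuting rho -> (forall b, log_bound M (rho b)) ->
  joined M rho rho.
Proof.
by move=> crho brho; exists (fun=> rho) => //; split=> // b t0;
  exact: c1path_at_cst.
Qed.

Lemma joined_trans M rho1 rho2 rho3 :
  joined M rho1 rho2 -> joined M rho2 rho3 -> joined M rho1 rho3.
Proof.
move=> [g [g0 g1 gc gp] gb] [h [h0 h1 hc hp] hb].
exists (fun t => if t <= 1 / 2 then g (2 * t) else h (2 * t - 1)); last first.
  by move=> t b; case: ifP.
split=> [t t0|t t1|t|b t0].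
- by rewrite ifT ?g0 //; lra.
- by rewrite ifF ?h1 //; lra.
- by case: ifP.
- pose u1 t := g (2 * t) b; pose u2 t := h (2 * t - 1) b.
  rewrite (_ : (fun _ => _) = (fun t => if t <= 1 / 2 then u1 t else u2 t)).
    apply: c1path_at_glue => [_|_|]; rewrite /u1 /u2.
    + apply: (@c1path_at_comp (g ^~ b) (fun t => 2 * t)) => //.
      by apply: cvgM; [exact: cvg_cst|exact: cvg_id].
    + apply: (@c1path_at_comp (h ^~ b) (fun t => 2 * t - 1)) => //.
      apply: cvgB; last exact: cvg_cst.
      by apply: cvgM; [exact: cvg_cst|exact: cvg_id].
    + by rewrite g1 ?h0 //; lra.
  by apply/funext => t; case: ifP.
Qed.

Lemma log_bound_id f M : c1diff f -> log_bound M f -> forall x, 0 <= x <= 1 ->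
  `|f x - x| <= expR M - 1 /\ `|der f x - 1| <= expR M - 1.
Proof.
move=> cf bf.
have bd x : 0 <= x <= 1 -> `|der f x - 1| <= expR M - 1.
  move=> x01; have := bf x x01; rewrite ler_norml => /andP[lo hi].
  have lnf : expR (ln (der f x)) = der f x by rewrite lnK // posrE c1_derive_gt0.
  have hi' : der f x <= expR M by rewrite -lnf ler_expR.
  have lo' : expR (- M) <= der f x by rewrite -lnf ler_expR.
  rewrite ler_norml; apply/andP; split; last by lra.
  have := expR_ge1Dx M; have := expR_ge1Dx (- M); lra.
move=> x x01; split; last exact: bd.
have [x0 x1] := andP x01.
have [z zx] := c1_mvt cf x0; rewrite (c1_fix0 cf) !subr0 => ->.
rewrite -{2}[x]mul1r -mulrBl normrM (ger0_norm x0).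
have z01 : 0 <= z <= 1 by lra.
have := bd z z01; have := normr_ge0 (der f z - 1); nra.
Qed.

End Paths.

(** * Infinite concatenation of paths shrinking to the identity *)

Section InfiniteConcatenation.
Context {R : realType}.
Variables (rho : nat -> bool -> R -> R) (gamma : nat -> R -> bool -> R -> R).
Variable M : nat -> R.
Hypothesis gamma_path : forall n, is_path (gamma n) (rho n) (rho n.+1).
Hypothesis gamma_bound : forall n t b, log_bound (M n) (gamma n t b).
Hypothesis M_noninc : forall n, M n.+1 <= M n.
Hypothesis M_to0 : forall e, 0 < e -> exists n, M n < e.

(** The concatenation of the first n paths, the k-th of them being run during
    [k, k + 1]; it is constant afterwards. *)
Fixpoint concat n : R -> bool -> R -> R :=
  if n is m.+1 then
    fun t => if t <= m%:R then concat m t else gamma m (t - m%:R)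
  else fun=> rho 0.

Lemma concat_ge n t : n%:R <= t -> concat n t = rho n.
Proof.
case: n => [//|n] nt /=.
have [_ g1 _ _] := gamma_path n.
by rewrite -natr1 in nt; rewrite ifF ?g1 //; lra.
Qed.

Lemma concat_le0 n t : t <= 0 -> concat n t = rho 0.
Proof.
move=> t0; elim: n => [//|n IHn] /=.
by rewrite ifT //; have := ler0n R n; lra.
Qed.

Lemma concat_stable n m t : (n <= m)%N -> t <= n%:R -> concat m t = concat n t.
Proof.
move=> nm tn; elim: m nm => [|m IHm]; first by rewrite leqn0 => /eqP->.
rewrite leq_eqVlt => /predU1P[<-//|]; rewrite ltnS => nm /=.
by rewrite ifT ?IHm // (le_trans tn) ?ler_nat.
Qed.

Lemma concat_commuting n t : commuting (concat n t).
Proof.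
elim: n => [|n IHn] /=; last first.
  by case: ifP => // _; have [_ _ gc _] := gamma_path n.
by have [g0 _ gc _] := gamma_path 0; rewrite -(g0 0).
Qed.

Lemma concat_c1path n b t0 : c1path_at (fun t => concat n t b) t0.
Proof.
elim: n => [|n IHn] /=; first exact: c1path_at_cst.
pose u t := gamma n (t - n%:R) b.
rewrite (_ : (fun _ => _) = (fun t => if t <= n%:R then concat n t b else u t)).
  have [g0 _ _ gp] := gamma_path n.
  apply: c1path_at_glue => // [_|]; last by rewrite /u subrr g0 // concat_ge.
  apply: (@c1path_at_comp _ (fun t => gamma n t b) (fun t => t - n%:R)) => //.
  by apply: cvgB; [exact: cvg_id|exact: cvg_cst].
by apply/funext => t; case: ifP.
Qed.

Lemma concat_bound n m t b : (n < m)%N -> n%:R <= t -> log_bound (M n) (concat m t b).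
Proof.
have Mnm k l : (k <= l)%N -> M l <= M k.
  move=> kl; rewrite -(subnK kl); elim: (l - k)%N => [//|i].
  by apply: le_trans; exact: M_noninc.
elim: m => [//|m IHm]; rewrite ltnS => nm nt /=; case: ifP => [tm|/negbT].
  move: nm; rewrite leq_eqVlt => /predU1P[nm|nm]; last exact: IHm.
  have {tm nt} -> : t = m%:R by apply/le_anti; rewrite tm -{1}nm.
  have [g0 _ _ _] := gamma_path m.
  by rewrite concat_ge // -(g0 0 (lexx _)) nm.
by move=> _ x x01; rewrite (le_trans (gamma_bound _ _ _ x01)) ?Mnm.
Qed.

(** The half-line is compressed to t < 1 by the change of time t / (1 - t).  At
    time s the concatenations of length at least s agree, so any of them may be
    used. *)
Definition limit_path (t : R) : bool -> R -> R :=
  if t < 1 then let s := t / (1 - t) in concat (Num.trunc s).+1 s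
  else fun=> idfun.

Lemma limit_pathE n t : t < 1 -> t / (1 - t) <= n%:R ->
  limit_path t = concat n (t / (1 - t)).
Proof.
move=> t1 sn; rewrite /limit_path t1.
have sK : t / (1 - t) <= (Num.trunc (t / (1 - t))).+1%:R.
  by apply: ltW; exact: truncnS_gt.
by case: (leqP n (Num.trunc (t / (1 - t))).+1) => [|/ltnW] h;
  [|symmetry]; exact: concat_stable.
Qed.

(** At t = 1 continuity comes from the bounds: close to time 1 the path runs
    through pairs with log-derivative at most M n, hence C^1-close to the
    identity. *)
Lemma is_path_limit : is_path limit_path (rho 0) (fun=> idfun).
Proof.
split=> [t t0|t t1|t|b t0].
- rewrite /limit_path ifT; last by lra.
  by rewrite concat_le0 // mulr_le0_ge0 // invr_ge0; lra.
- by rewrite /limit_path ifF //; apply/negbTE; rewrite -leNgt.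
- rewrite /limit_path; case: ifP => _; first exact: concat_commuting.
  by split=> // b; exact: (proj1 c1diff_id).
have [t01|t01|t01] := ltgtP t0 1.
- pose s (t : R) := t / (1 - t).
  have cs : {for t0, continuous s}.
    apply: cvgM; first exact: cvg_id.
    by apply: cvgV; [rewrite subr_eq0 gt_eqF|apply: cvgB; [exact: cvg_cst|exact: cvg_id]].
  have [n sn] : exists n, s t0 < n%:R.
    by exists (Num.trunc (s t0)).+1; exact: truncnS_gt.
  apply: (@c1path_at_near_eq _ (fun t => concat n (s t) b)); last first.
    exact: (@c1path_at_comp _ (fun t => concat n t b)) (concat_c1path _ _ _).
  near=> t; rewrite (@limit_pathE n) //; near: t; first exact: lt_nbhsl.
  near=> t; apply: ltW; near: t; exact: (cvgr_lt _ cs).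
- apply: (@c1path_at_near_eq _ (fun=> idfun)); last exact: c1path_at_cst.
  near=> t; rewrite /limit_path ifF //; apply/negbTE; rewrite -leNgt ltW //.
  by near: t; exact: lt_nbhsr.
have main e : 0 < e -> \forall t \near t0, forall x, 0 <= x <= 1 ->
    `|limit_path t b x - x| < e /\ `|der (limit_path t b) x - 1| < e.
  move=> e0; have [n Mn] : exists n, M n < ln (1 + e).
    by apply: M_to0; apply: ln_gt0; lra.
  have Me : expR (M n) - 1 < e.
    have : expR (M n) < expR (ln (1 + e)) by rewrite ltr_expR.
    by rewrite lnK ?posrE; lra.
  pose s (t : R) := t / (1 - t).
  near=> t => x x01.
  have [t1|t1] := ltP t 1; last first.
    have -> : limit_path t = fun=> idfun by rewrite /limit_path ltNge t1.
    rewrite (proj2 c1diff_id) /= !subrr normr0.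
    by split.
  have sn : n%:R <= s t.
    (* For t so close to 1, the time s t is past n. *)
    have nt : 1 - n.+1%:R^-1 < t.
      by near: t; apply: lt_nbhsr; rewrite t01 gtrBl invr_gt0.
    rewrite /s ler_pdivlMr; last by lra.
    have := ltr0Sn R n => n0.
    have : n.+1%:R * (1 - n.+1%:R^-1) < n.+1%:R * t by rewrite ltr_pM2l.
    by rewrite mulrBr mulr1 divff ?gt_eqF // -natr1; lra.
  pose m := maxn n.+1 (Num.trunc (s t)).+1.
  have sm : s t <= m%:R.
    apply: (@le_trans _ _ (Num.trunc (s t)).+1%:R); last by rewrite ler_nat leq_maxr.
    by apply: ltW; exact: truncnS_gt.
  rewrite (limit_pathE t1 sm).
  have bn : log_bound (M n) (concat m (s t) b) by apply: concat_bound => //; rewrite leq_maxl.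
  have [cd _] := concat_commuting m (s t).
  by have [h1 h2] := log_bound_id (cd b) bn x01; split; lra.
have l1 : limit_path t0 b = idfun by rewrite /limit_path t01 ltxx.
split=> e /main h; rewrite ?l1.
  by apply: filterS h => t h x /h[].
by rewrite (proj2 c1diff_id); apply: filterS h => t h x /h[].
Unshelve. all: by end_near. Qed.

End InfiniteConcatenation.

Lemma joined_limit (R : realType) (rho : nat -> bool -> R -> R) (M : nat -> R) :
    (forall n, joined (M n) (rho n) (rho n.+1)) ->
    (forall n, M n.+1 <= M n) -> (forall e, 0 < e -> exists n, M n < e) ->
  exists gamma, is_path gamma (rho 0) (fun=> idfun).
Proof.
move=> j Mn M0.
have ex n : exists g, is_path g (rho n) (rho n.+1) /\
    forall t b, log_bound (M n) (g t b).
  by have [g pg bg] := j n; exists g.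
have [gamma hg] := choice ex; exists (limit_path rho gamma).
by apply: (@is_path_limit _ _ _ M) => // [n|n]; case: (hg n).
Qed.

(** * Paths obtained by conjugation *)

Section Conjugation.
Context {R : realType}.
Implicit Types (f h psi chi : R -> R) (rho : bool -> R -> R) (M c s : R).

(** The curve u t = psi t o f o (psi t)^-1 is continuous as soon as psi t and
    Q t, the derivative of u t transported to the source by psi t, are.  One
    compares u t and u t0 at the point psi t x, where u t takes the value
    psi t (f x); the discrepancy between psi t x and psi t0 x is absorbed by the
    uniform continuity of u t0, so the inverses never enter the estimate. *)
Lemma conj_c1path (u psi Q : R -> R -> R) f t0 :
    (forall t, c1diff (u t)) -> (forall x, 0 <= x <= 1 -> 0 <= f x <= 1) ->
    (forall t x, 0 <= x <= 1 -> 0 <= psi t x <= 1) ->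
    (forall t y, 0 <= y <= 1 -> exists2 x, 0 <= x <= 1 & psi t x = y) ->
    (forall t x, u t (psi t x) = psi t (f x)) ->
    (forall t x, 0 <= x <= 1 -> der (u t) (psi t x) = Q t x) ->
    unif_at psi t0 -> unif_at Q t0 ->
  c1path_at u t0.
Proof.
move=> cu f01 psi01 psi_surj uE duE cpsi cQ.
have main (v : R -> R) e : continuous v -> 0 < e ->
    \forall t \near t0, forall x, 0 <= x <= 1 -> `|v (psi t x) - v (psi t0 x)| < e.
  move=> cv e0; have [d d0 hd] := unif_continuous01 cv e0.
  near=> t => x x01; apply: hd; first exact: psi01.
  by move: x x01; near: t; exact: cpsi.
have half (e : R) : 0 < e -> 0 < e / 2 by move=> e0; lra.
split=> e /half e0.
- near=> t => y /(psi_surj t)[x x01 <-].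
  have h1 : `|u t0 (psi t x) - u t0 (psi t0 x)| < e / 2.
    by move: x x01; near: t; apply: main => //; exact: c1_continuous.
  have h2 : `|psi t (f x) - psi t0 (f x)| < e / 2.
    by move: {h1} (f x) (f01 x x01); near: t; exact: cpsi.
  rewrite !uE in h1 *; rewrite (splitr e) -(subrKA (psi t0 (f x))).
  by rewrite (le_lt_trans (ler_normD _ _)) // ltrD // distrC.
- near=> t => y /(psi_surj t)[x x01 <-].
  have h1 : `|der (u t0) (psi t x) - der (u t0) (psi t0 x)| < e / 2.
    by move: x x01; near: t; apply: main => //; exact: c1_continuous_derive.
  have h2 : `|Q t x - Q t0 x| < e / 2.
    by move: {h1} x x01; near: t; exact: cQ.
  rewrite (duE t0) // in h1; rewrite duE //.
  rewrite (splitr e) -(subrKA (Q t0 x)).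
  by rewrite (le_lt_trans (ler_normD _ _)) // ltrD // distrC.
Unshelve. all: by end_near. Qed.

Lemma log_boundP M f : c1diff f ->
  log_bound M f <->
  forall x, 0 <= x <= 1 -> expR (- M) <= der f x <= expR M.
Proof.
move=> cf; have e x : der f x = expR (ln (der f x)).
  by rewrite lnK // posrE c1_derive_gt0.
by split=> h x /h; rewrite ler_norml [der f x]e !ler_expR // expRK.
Qed.

(** Linear growth at both ends, then the intermediate value theorem. *)
Lemma continuous_surj (f : R -> R) c : continuous f -> 0 < c ->
    (forall x, 0 <= x -> c * x <= f x) -> (forall x, x <= 0 -> f x <= c * x) ->
  forall y, exists x, f x = y.
Proof.
move=> cf c0 fpos fneg y; pose k := `|y| / c.
have k0 : 0 <= k by rewrite divr_ge0 // ltW.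
have ck : c * k = `|y| by rewrite mulrC divfK // gt_eqF.
have h1 : y <= f k by rewrite (le_trans (ler_norm y)) // -ck fpos.
have h2 : f (- k) <= y.
  apply: (@le_trans _ _ (c * - k)); first by apply: fneg; lra.
  by rewrite mulrN ck lerNl -normrN ler_norm.
have [||x _ <-] := @IVT R f (- k) k y _ (continuous_subspaceT cf); first by lra.
  by rewrite ge_min h2 le_max h1 orbT.
by exists x.
Qed.

Lemma c1_sign f x : c1diff f -> (0 <= x -> 0 <= f x) /\ (x <= 0 -> f x <= 0).
Proof.
by move=> cf; split=> x0; rewrite -{1}(c1_fix0 cf) ?(c1_mono_le cf) //
  -[leRHS](c1_fix0 cf) (c1_mono_le cf).
Qed.

Lemma c1diff_convex s psi : 0 <= s <= 1 -> c1diff psi ->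
  c1diff (fun x => (1 - s) * x + s * psi x) /\
  der (fun x => (1 - s) * x + s * psi x) = (fun x => (1 - s) + s * der psi x).
Proof.
move=> /andP[s0 s1] cpsi.
have dpos x : 0 < (1 - s) + s * der psi x.
  have d0 := c1_derive_gt0 cpsi x; have [->|sn0] := eqVneq s 0; first by lra.
  have : 0 < s * der psi x by rewrite mulr_gt0 // lt_neqAle eq_sym sn0.
  by lra.
have isd (x : R) : is_derive x (1 : R) (fun x => (1 - s) * x + s * psi x) ((1 - s) + s * der psi x).
  have dp := c1_is_derive x cpsi.
  rewrite -[X in _ X (_ + _)]/(((1 - s) \*: (idfun : R -> R)) + (s \*: psi)).
  by apply: is_derive_eq; rewrite /GRing.scale /= mulr1.
have cont : continuous (fun x => (1 - s) * x + s * psi x).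
  move=> x; apply: cvgD; apply: cvgM; try exact: cvg_cst; first exact: cvg_id.
  exact: c1_continuous.
apply: c1diff_of_is_derive => //.
- move=> x; apply: cvgD; first exact: cvg_cst.
  by apply: cvgM; [exact: cvg_cst|exact: c1_continuous_derive].
- by rewrite (c1_fix0 cpsi); lra.
- by rewrite (c1_fix1 cpsi); lra.
have [->|sn1] := eqVneq s 1.
  move=> y; have [x <-] := c1_surj cpsi y; exists x; lra.
have s1' : s < 1 by rewrite lt_neqAle sn1.
apply: (@continuous_surj _ (1 - s)) => //; first by lra.
- by move=> x x0; have := proj1 (c1_sign x cpsi) x0; nra.
- by move=> x x0; have := proj2 (c1_sign x cpsi) x0; nra.
Qed.

Definition conjugate psi chi rho : bool -> R -> R := fun b => psi \o rho b \o chi.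

(** The derivative of the conjugate is taken at psi x, where it involves neither
    the inverse map nor its derivative. *)
Lemma c1diff_conj psi chi f : c1diff psi -> cancel psi chi -> cancel chi psi ->
    c1diff f -> c1diff (psi \o f \o chi) /\
  forall x, der (psi \o f \o chi) (psi x) = der psi (f x) * der f x / der psi x.
Proof.
move=> cpsi psiK chiK cf.
have [cchi dchi] := c1diff_inverse cpsi psiK chiK.
have [c1 d1] := c1diff_comp cpsi cf; have [c2 d2] := c1diff_comp c1 cchi.
by split=> // x; rewrite d2 d1 dchi psiK.
Qed.

Lemma commuting_conj psi chi rho : cancel psi chi ->
    (forall b, c1diff (conjugate psi chi rho b)) -> commuting rho ->
  commuting (conjugate psi chi rho).
Proof.
by move=> psiK cc [_ crho]; split=> // b b' x; rewrite /conjugate /= !psiK crho.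
Qed.

Definition clamp (t : R) := Num.max 0 (Num.min t 1).

Lemma clamp01 t : 0 <= clamp t <= 1.
Proof. by rewrite /clamp le_max lexx ge_max ler01 ge_min lexx orbT. Qed.

Lemma clamp_le0 t : t <= 0 -> clamp t = 0.
Proof. by move=> t0; rewrite /clamp max_l // ge_min t0. Qed.

Lemma clamp_ge1 t : 1 <= t -> clamp t = 1.
Proof. by move=> t1; rewrite /clamp min_r // max_r ?ler01. Qed.

Lemma clamp_id t : 0 <= t <= 1 -> clamp t = t.
Proof. by move=> /andP[t0 t1]; rewrite /clamp min_l // max_r. Qed.

Lemma continuous_clamp : continuous clamp.
Proof.
move=> t; have := @continuous_max _ R (cst 0) (idfun \min cst 1) t.
apply; first exact: cvg_cst.
by apply: continuous_min; [exact: cvg_id|exact: cvg_cst].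
Qed.

(** The common mechanism of the two deformations used below, by convex
    combinations and by powers: a family of conjugating homeomorphisms Psi t,
    possibly not smooth, whose conjugates of rho are C^1. *)
Lemma joined_conj_family M (Psi Chi : R -> R -> R) (Q : bool -> R -> R -> R) rho :
    commuting rho ->
    (forall t, 0 <= t <= 1 -> cancel (Psi t) (Chi t) /\ cancel (Chi t) (Psi t)) ->
    (forall t x, 0 <= t <= 1 -> 0 <= x <= 1 ->
      0 <= Psi t x <= 1 /\ 0 <= Chi t x <= 1) ->
    (forall b t, 0 <= t <= 1 -> c1diff (conjugate (Psi t) (Chi t) rho b)) ->
    (forall b t x, 0 <= t <= 1 -> 0 <= x <= 1 ->
      der (conjugate (Psi t) (Chi t) rho b) (Psi t x) = Q b t x) ->
    (forall b t x, 0 <= t <= 1 -> 0 <= x <= 1 ->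
      expR (- M) <= Q b t x <= expR M) ->
    (forall t, 0 <= t <= 1 -> unif_at Psi t) ->
    (forall b t, 0 <= t <= 1 -> unif_at (Q b) t) ->
  joined M (conjugate (Psi 0) (Chi 0) rho) (conjugate (Psi 1) (Chi 1) rho).
Proof.
move=> crho PsiK Psi01 cu duE Qbound cPsi cQ.
exists (fun t => conjugate (Psi (clamp t)) (Chi (clamp t)) rho); last first.
  move=> t b; apply/log_boundP; first exact/cu/clamp01.
  move=> x x01; have t01 := clamp01 t.
  have [_ ChiK] := PsiK _ t01; have [_ chix] := Psi01 _ _ t01 x01.
  by rewrite -(ChiK x) duE // Qbound.
split=> [t t0|t t1|t|b t0]; [by rewrite clamp_le0|by rewrite clamp_ge1| |].
  have t01 := clamp01 t; have [PK _] := PsiK _ t01.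
  by apply: commuting_conj => // b; exact: cu.
apply: (@conj_c1path _ (fun t => Psi (clamp t)) (fun t => Q b (clamp t)) (rho b)).
- by move=> t; apply/cu/clamp01.
- by move=> x; apply: c1_01; case: crho.
- by move=> t x x01; case: (Psi01 _ _ (clamp01 t) x01).
- move=> t y y01; exists (Chi (clamp t) y).
    by case: (Psi01 _ _ (clamp01 t) y01).
  by case: (PsiK _ (clamp01 t)).
- by move=> t x; rewrite /conjugate /= (proj1 (PsiK _ (clamp01 t))).
- by move=> t x x01; apply: duE => //; exact: clamp01.
- by apply: unif_at_comp; [exact: continuous_clamp|exact/cPsi/clamp01].
- by apply: (@unif_at_comp _ (Q b)); [exact: continuous_clamp|exact/cQ/clamp01].
Qed.

(** Conjugating by (1 - t) id + t psi joins rho to its conjugate by psi.  The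
    derivative of the intermediate conjugate is
    ((1 - t) + t psi'(f x)) f'(x) / ((1 - t) + t psi'(x)), a mediant of f'(x) and
    of the derivative psi'(f x) f'(x) / psi'(x) of the final conjugate, so a
    bound common to both ends holds along the whole path. *)
Lemma joined_conj M psi chi rho :
    c1diff psi -> cancel psi chi -> cancel chi psi -> commuting rho ->
    (forall b, log_bound M (rho b)) ->
    (forall b, log_bound M (conjugate psi chi rho b)) ->
  joined M rho (conjugate psi chi rho).
Proof.
move=> cpsi psiK chiK crho brho bconj; have [c1rho _] := crho.
pose Psi (t x : R) : R := (1 - t) * x + t * psi x.
have cP (t : R) : 0 <= t <= 1 -> c1diff (Psi t).
  by move=> t01; exact: (proj1 (c1diff_convex t01 cpsi)).
have dP (t : R) : 0 <= t <= 1 -> der (Psi t) = (fun x => (1 - t) + t * der psi x).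
  by move=> t01; exact: (proj2 (c1diff_convex t01 cpsi)).
have inv (t : R) : exists g : R -> R, 0 <= t <= 1 ->
    cancel (Psi t) g /\ cancel g (Psi t).
  case: (boolP (0 <= t <= 1)) => [t01|_]; last by exists idfun.
  by have [g gK Kg] := c1_inverse (cP t t01); exists g.
have [Chi ChiP] := choice inv.
have P0 : Psi 0 = idfun by apply/funext => x; rewrite /Psi /=; lra.
have P1 : Psi 1 = psi by apply/funext => x; rewrite /Psi /=; lra.
have C0 : Chi 0 = idfun.
  apply/funext => x; have [] := ChiP 0; first by rewrite lexx ler01.
  by rewrite P0 => /(_ x).
have C1 : Chi 1 = chi.
  apply/funext => x; have [] := ChiP 1; first by rewrite lexx ler01.
  by rewrite P1 => + _ => /(_ (chi x)); rewrite chiK.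
pose Q b (t x : R) : R := ((1 - t) + t * der psi (rho b x)) * der (rho b) x /
  ((1 - t) + t * der psi x).
have e0 : conjugate (Psi 0) (Chi 0) rho = rho by rewrite P0 C0.
rewrite -P1 -C1 -[X in joined _ X _]e0.
have dpos (t x : R) : 0 <= t <= 1 -> 0 < (1 - t) + t * der psi x.
  by move=> t01; rewrite -[_ + _]/((fun x => (1 - t) + t * der psi x) x) -dP //;
    apply: c1_derive_gt0; exact: cP.
have cconj b (t : R) : 0 <= t <= 1 -> c1diff (conjugate (Psi t) (Chi t) rho b) /\
    forall x, der (conjugate (Psi t) (Chi t) rho b) (Psi t x) = Q b t x.
  move=> t01; have [PK CK] := ChiP t t01.
  have [c1 d1] := c1diff_conj (cP t t01) PK CK (c1rho b).
  by split=> // x; rewrite d1 dP.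
apply (@joined_conj_family M Psi Chi Q).
- exact: crho.
- exact: ChiP.
- move=> t x t01 x01; have [PK CK] := ChiP t t01.
  split; first exact: c1_01 (cP t t01) x01.
  exact: c1_01 (proj1 (c1diff_inverse (cP t t01) PK CK)) x01.
- by move=> b t /(cconj b)[].
- by move=> b t x /(cconj b)[].
- move=> b t x t01 x01.
  have /andP[t0 t1] := t01.
  have /(log_boundP M (c1rho b))/(_ x x01)/andP[lo hi] := brho b.
  have [cpr dpr] := c1diff_conj cpsi psiK chiK (c1rho b).
  have /(log_boundP M cpr)/(_ _ (c1_01 cpsi x01)) := bconj b.
  have dx0 := c1_derive_gt0 cpsi x.
  rewrite dpr ler_pdivlMr // ler_pdivrMr // => /andP[lo' hi'].
  have D0 := dpos t x t01.
  rewrite /Q ler_pdivlMr // ler_pdivrMr //; set e := expR (- M) in lo lo' *.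
  have h1 : 0 <= (1 - t) * (der (rho b) x - e) by apply: mulr_ge0; lra.
  have h2 : 0 <= (1 - t) * (expR M - der (rho b) x) by apply: mulr_ge0; lra.
  have h3 := ler_wpM2l t0 lo'; have h4 := ler_wpM2l t0 hi'.
  by apply/andP; split; lra.
- move=> t t01; apply: joint_unif_at => x x01; apply: cvgD; apply: cvgM.
  + by apply: cvgB; [exact: cvg_cst|exact: cvg_fst].
  + exact: cvg_snd.
  + exact: cvg_fst.
  + by apply: continuous_comp; [exact: cvg_snd|exact: c1_continuous].
- move=> b t t01; apply: joint_unif_at => x x01.
  have cc (v : R -> R) : continuous v -> {for (t, x), continuous (fun p : R * R => (1 - p.1) + p.1 * v p.2)}.
    move=> cv; apply: cvgD; first by apply: cvgB; [exact: cvg_cst|exact: cvg_fst].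
    apply: cvgM; first exact: cvg_fst.
    by apply: continuous_comp; [exact: cvg_snd|exact: cv].
  apply: cvgM; first apply: cvgM.
  + apply: (cc (der psi \o rho b)) => y; apply: continuous_comp.
      exact: c1_continuous.
    exact: c1_continuous_derive.
  + by apply: continuous_comp; [exact: cvg_snd|exact: c1_continuous_derive].
  + apply: cvgV; first by rewrite gt_eqF // dpos.
    by apply: cc; exact: c1_continuous_derive.
Qed.

End Conjugation.

(** * Conjugation by weighted averages of iterates *)

Section Averaging.
Context {R : realType}.
Implicit Types (f h : R -> R) (rho : bool -> R -> R) (c k x : R) (v : nat -> R).

Definition der_le f k := forall x, 0 <= x <= 1 -> der f x <= k.
Definition der_ge f k := forall x, 0 <= x <= 1 -> k <= der f x.

Definition average n v f x := \sum_(i < n.+1) v i * iter i f x.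

Lemma continuous_big_sum n (F : 'I_n -> R -> R) : (forall i, continuous (F i)) ->
  continuous (fun x => \sum_(i < n) F i x).
Proof.
elim: n F => [|n IHn] F cF.
  by under eq_fun do rewrite big_ord0; move=> x; exact: cvg_cst.
under eq_fun do rewrite big_ord_recl.
by move=> x; apply: cvgD; [exact: cF|exact: IHn].
Qed.

Lemma c1diff_average n v f : (forall i, 0 < v i) -> \sum_(i < n.+1) v i = 1 ->
    c1diff f -> c1diff (average n v f) /\
  der (average n v f) = (fun x => \sum_(i < n.+1) v i * der (iter i f) x).
Proof.
move=> v0 v1 cf; have cfi i := c1diff_iter i cf.
have vge i x y : x <= y -> v i * x <= v i * y by rewrite ler_pM2l.
have cav : continuous (average n v f).
  apply: continuous_big_sum => i x; apply: cvgM; first exact: cvg_cst.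
  exact: c1_continuous.
apply: c1diff_of_is_derive.
- move=> x; have dfi i := c1_is_derive x (cfi i).
  rewrite -[X in is_derive _ _ X _]/(fun x => \sum_(i < n.+1) (v i \*: iter i f) x).
  by rewrite -fct_sumE; apply: is_derive_eq.
- apply: continuous_big_sum => i x; apply: cvgM; first exact: cvg_cst.
  exact: c1_continuous_derive.
- move=> x; rewrite big_ord_recl ltr_pwDl ?mulr_gt0 ?c1_derive_gt0 //.
  by apply: sumr_ge0 => i _; rewrite mulr_ge0 // ltW // c1_derive_gt0.
- by rewrite /average big1 // => i _; rewrite (c1_fix0 (cfi i)) mulr0.
- rewrite /average -{2}v1; apply: eq_bigr => i _.
  by rewrite (c1_fix1 (cfi i)) mulr1.
- apply: (@continuous_surj _ _ (v 0)) => // x x0.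
    rewrite /average big_ord_recl /= lerDl sumr_ge0 // => i _.
    by rewrite mulr_ge0 ?(ltW (v0 _)) //; exact: (proj1 (c1_sign x (cfi i.+1))).
  rewrite /average big_ord_recl /= gerDl sumr_le0 // => i _.
  by rewrite pmulr_rle0 //; exact: (proj2 (c1_sign x (cfi i.+1))).
Qed.

Lemma der_comp f h x : c1diff f -> c1diff h ->
  der (fun x => f (h x)) x = der f (h x) * der h x.
Proof. by move=> cf ch; have [_ ->] := c1diff_comp cf ch. Qed.

Lemma iter_commute f h i x : (forall x, f (h x) = h (f x)) ->
  iter i f (h x) = h (iter i f x).
Proof. by move=> fh; elim: i => //= i ->. Qed.

(** If h commutes with f, then the average composed with h is the average of the
    maps h o f^i; hence the derivative of the conjugate of h by the average is a
    weighted mean of the values of h' along the f-orbit. *)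
Lemma der_average_commute n v f h x : (forall i, 0 < v i) ->
    \sum_(i < n.+1) v i = 1 -> c1diff f -> c1diff h ->
    (forall x, f (h x) = h (f x)) ->
  der (average n v f) (h x) * der h x =
  \sum_(i < n.+1) der h (iter i f x) * (v i * der (iter i f) x).
Proof.
move=> v0 v1 cf ch fh; have [_ ->] := c1diff_average v0 v1 cf.
rewrite big_distrl; apply: eq_bigr => i _ /=; have cfi := c1diff_iter i cf.
rewrite -mulrA [RHS]mulrCA -!der_comp //.
suff -> : (fun y => iter i f (h y)) = (fun y => h (iter i f y)) by [].
by apply/funext => y; exact: iter_commute.
Qed.

(** A weighted mean of values of h' stays between the bounds of h'. *)
Lemma average_conj_bounds n v f h chi : (forall i, 0 < v i) ->
    \sum_(i < n.+1) v i = 1 -> c1diff f -> c1diff h ->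
    (forall x, f (h x) = h (f x)) ->
    cancel (average n v f) chi -> cancel chi (average n v f) ->
  (forall k, der_le h k -> der_le (average n v f \o h \o chi) k) /\
  (forall k, der_ge h k -> der_ge (average n v f \o h \o chi) k).
Proof.
move=> v0 v1 cf ch fh aK Ka; have [ca da] := c1diff_average v0 v1 cf.
have [cc dc] := c1diff_conj ca aK Ka ch.
have [cchi _] := c1diff_inverse ca aK Ka.
have main x : der (average n v f \o h \o chi) x * der (average n v f) (chi x) =
    \sum_(i < n.+1) der h (iter i f (chi x)) * (v i * der (iter i f) (chi x)).
  rewrite -{1}(Ka x) dc divfK ?gt_eqF ?c1_derive_gt0 //.
  exact: der_average_commute.
have i01 i x : 0 <= x <= 1 -> 0 <= iter i f (chi x) <= 1.
  by move=> x01; apply: c1_01; [exact: c1diff_iter|exact: c1_01].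
have wpos i x : 0 <= v i * der (iter i f) x.
  by rewrite mulr_ge0 ?ltW // c1_derive_gt0 //; exact: c1diff_iter.
split=> k hk x x01; rewrite -(ler_pM2r (c1_derive_gt0 ca (chi x))) main da
    big_distrr /=; apply: ler_sum => i _; apply: ler_wpM2r => //; exact/hk/i01.
Qed.

Lemma der_iterSr f i x : c1diff f ->
  der (iter i f) (f x) * der f x = der (iter i.+1 f) x.
Proof.
move=> cf; rewrite -der_comp //; last exact: c1diff_iter.
suff -> : (fun y => iter i f (f y)) = iter i.+1 f by [].
by apply/funext => y; rewrite iterSr.
Qed.

(** With the weights c^-i the sum over i <= n telescopes:
    (phi o f)' = c phi' + c / W ((f^(n+1))' / c^(n+1) - 1), where W is the total
    weight.  The sign of the last term decides on which side of c the derivative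
    of the conjugate of f by phi lies.  The case c > 1 lowers large derivatives,
    the case c < 1 raises small ones. *)
Lemma geometric_average_conj n c f : 0 < c -> c1diff f ->
    let v i := c ^- i / \sum_(j < n.+1) c ^- j in
    forall chi, cancel (average n v f) chi -> cancel chi (average n v f) ->
  (der_le (iter n.+1 f) (c ^+ n.+1) -> der_le (average n v f \o f \o chi) c) /\
  (der_ge (iter n.+1 f) (c ^+ n.+1) -> der_ge (average n v f \o f \o chi) c).
Proof.
move=> c0 cf v chi aK Ka; set W := \sum_(j < n.+1) c ^- j in v aK Ka *.
have ci0 i : 0 < c ^- i by rewrite invr_gt0 exprn_gt0.
have W0 : 0 < W.
  by rewrite /W big_ord_recl ltr_pwDl // sumr_ge0 // => i _; rewrite ltW.
have v0 i : 0 < v i by rewrite divr_gt0.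
have v1 : \sum_(i < n.+1) v i = 1 by rewrite -big_distrl /= divff // gt_eqF.
have [ca da] := c1diff_average v0 v1 cf.
have [cc dc] := c1diff_conj ca aK Ka cf.
have [cchi _] := c1diff_inverse ca aK Ka.
pose a i x : R := der (iter i f) x.
have tele x : der (average n v f) (f x) * der f x =
    c * der (average n v f) x + c / W * (a n.+1 x / c ^+ n.+1 - 1).
  have -> : der (average n v f) (f x) * der f x =
      c / W * \sum_(i < n.+1) c ^- i.+1 * a i.+1 x.
    rewrite da big_distrl big_distrr /=; apply: eq_bigr => i _.
    rewrite -[LHS]mulrA der_iterSr // /v /a exprS invfM; set p := c ^- i.
    have : c * c^-1 = 1 by rewrite divff // gt_eqF.
    move: (der _ x : R) (c^-1) (W^-1) => D q w e.
    by rewrite -[LHS]mul1r -e; lra.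
  have -> : der (average n v f) x = W^-1 * \sum_(i < n.+1) c ^- i * a i x.
    by rewrite da big_distrr /=; apply: eq_bigr => i _; rewrite /v /a mulrAC mulrC.
  have a0 : c ^- 0 * a 0%N x = 1.
    by rewrite expr0 invr1 mul1r /a /= (proj2 c1diff_id).
  have eL : \sum_(i < n.+2) c ^- i * a i x =
      1 + \sum_(i < n.+1) c ^- i.+1 * a i.+1 x by rewrite big_ord_recl a0.
  have : \sum_(i < n.+2) c ^- i * a i x =
      \sum_(i < n.+1) c ^- i * a i x + c ^- n.+1 * a n.+1 x by rewrite big_ord_recr.
  rewrite eL; move: (\sum_(i < _) _) (\sum_(i < _) _) => S0 S1.
  rewrite [a n.+1 x / _]mulrC; move: (c ^- n.+1 * _) => y e.
  have -> : S1 = S0 + y - 1 by lra.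
  lra.
have chi01 x : 0 <= x <= 1 -> 0 <= chi x <= 1 by exact: c1_01.
have main x : der (average n v f \o f \o chi) x * der (average n v f) (chi x) =
    c * der (average n v f) (chi x) + c / W * (a n.+1 (chi x) / c ^+ n.+1 - 1).
  by rewrite -tele -{1}(Ka x) dc divfK // gt_eqF // c1_derive_gt0.
have cW : 0 < c / W by rewrite divr_gt0.
split=> h x x01; rewrite -(ler_pM2r (c1_derive_gt0 ca (chi x))) main.
  rewrite gerDl pmulr_rle0 // subr_le0 ler_pdivrMr ?exprn_gt0 // mul1r.
  exact/h/chi01.
rewrite lerDl pmulr_rge0 // subr_ge0 ler_pdivlMr ?exprn_gt0 // mul1r.
exact/h/chi01.
Qed.

Lemma average_step rho b0 n c : 0 < c -> commuting rho ->
  exists psi chi, [/\ c1diff psi, cancel psi chi & cancel chi psi] /\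
  [/\ forall b k, der_le (rho b) k -> der_le (conjugate psi chi rho b) k,
      forall b k, der_ge (rho b) k -> der_ge (conjugate psi chi rho b) k,
      der_le (iter n.+1 (rho b0)) (c ^+ n.+1) -> der_le (conjugate psi chi rho b0) c &
      der_ge (iter n.+1 (rho b0)) (c ^+ n.+1) -> der_ge (conjugate psi chi rho b0) c].
Proof.
move=> c0 [c1rho crho]; pose W := \sum_(j < n.+1) c ^- j.
pose v i := c ^- i / W.
have ci0 i : 0 < c ^- i by rewrite invr_gt0 exprn_gt0.
have W0 : 0 < W.
  by rewrite /W big_ord_recl ltr_pwDl // sumr_ge0 // => i _; rewrite ltW.
have v0 i : 0 < v i by rewrite divr_gt0.
have v1 : \sum_(i < n.+1) v i = 1 by rewrite -big_distrl /= divff // gt_eqF.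
have [ca _] := c1diff_average v0 v1 (c1rho b0).
have [chi aK Ka] := c1_inverse ca.
exists (average n v (rho b0)), chi; split=> //.
have bnd b := average_conj_bounds v0 v1 (c1rho b0) (c1rho b) (crho b0 b) aK Ka.
have [g1 g2] := geometric_average_conj c0 (c1rho b0) aK Ka.
by split=> // b; case: (bnd b).
Qed.

End Averaging.

(** * Signed powers *)

Section SignedPower.
Context {R : realType}.
Implicit Types (s t u v x y : R).

Definition spow s u : R := Num.sg u * `|u| `^ s.

Lemma spow0 s : spow s 0 = 0.
Proof. by rewrite /spow sgr0 mul0r. Qed.

Lemma spow1 u : spow 1 u = u.
Proof. by rewrite /spow powRr1 // -numEsg. Qed.

Lemma norm_spow s u : s != 0 -> `|spow s u| = `|u| `^ s.
Proof.
move=> s0; rewrite /spow normrM normr_sg (ger0_norm (powR_ge0 _ _)).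
by have [->|u0] := eqVneq u 0; rewrite ?mul1r // mul0r normr0 powR0.
Qed.

Lemma sg_spow s u : Num.sg (spow s u) = Num.sg u.
Proof.
rewrite /spow sgrM sgr_id; have [->|u0] := eqVneq u 0; first by rewrite sgr0 mul0r.
by rewrite (@gtr0_sg _ (_ `^ _)) ?mulr1 // powR_gt0 // normr_gt0.
Qed.

Lemma spowK s : s != 0 -> cancel (spow s) (spow s^-1).
Proof.
move=> s0 u; rewrite {1}/spow sg_spow norm_spow // -powRrM divff // powRr1 //.
by rewrite -numEsg.
Qed.

Lemma spowM s u q : 0 < q -> spow s (q * u) = q `^ s * spow s u.
Proof.
move=> q0; rewrite /spow sgrM (gtr0_sg q0) mul1r normrM (gtr0_norm q0).
by rewrite powRM // ?(ltW q0) // mulrCA.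
Qed.

Lemma spowN s u : spow s (- u) = - spow s u.
Proof. by rewrite /spow sgrN normrN mulNr. Qed.

Lemma spow_gt0 s u : 0 < u -> spow s u = u `^ s.
Proof. by move=> u0; rewrite /spow gtr0_sg // mul1r gtr0_norm. Qed.

Lemma spow_le s u v : 0 < s -> u <= v -> spow s u <= spow s v.
Proof.
move=> s0.
have pos (x y : R) : 0 <= x -> x <= y -> spow s x <= spow s y.
  rewrite le_eqVlt => /predU1P[<-|x0] xy.
    by rewrite spow0 /spow mulr_ge0 ?powR_ge0 // sgr_ge0.
  have y0 : 0 < y by exact: lt_le_trans xy.
  by rewrite !spow_gt0 // ge0_ler_powR // ?nnegrE ltW.
have [u0|u0] := leP 0 u; first exact: pos.
have [v0 _|v0 uv] := leP 0 v.
  apply: (@le_trans _ _ 0); last by rewrite -(spow0 s) pos.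
  by rewrite -oppr_ge0 -spowN -(spow0 s) pos // oppr_ge0 ltW.
by rewrite -lerN2 -!spowN pos ?lerN2 // oppr_ge0 ltW.
Qed.

Lemma is_derive_spow s u : u != 0 ->
  is_derive u 1 (spow s) (s * `|u| `^ (s - 1)).
Proof.
rewrite neq_lt => /orP[u0|u0]; last first.
  rewrite gtr0_norm //; apply: near_eq_is_derive (is_derive1_powR s u0).
  by near=> v; rewrite spow_gt0 //; near: v; exact: lt_nbhsr.
have u0' : 0 < - u by rewrite oppr_gt0.
rewrite ltr0_norm //.
have d : is_derive u 1 (\- ((@powR R ^~ s) \o -%R)) (s * (- u) `^ (s - 1)).
  have dp : is_derive (- u) 1 (@powR R ^~ s) (s * (- u) `^ (s - 1)).
    exact: is_derive1_powR.
  have dc := is_derive1_comp dp (is_deriveNid u 1).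
  by apply: is_derive_eq; rewrite mulrN1 opprK.
apply: near_eq_is_derive d.
near=> v; rewrite -[v in RHS]opprK spowN spow_gt0 // oppr_gt0.
by near: v; exact: lt_nbhsl.
Unshelve. all: by end_near. Qed.

(** At u = 0 the exponent stays above s / 2, so |u|^(s / 2) dominates. *)
Lemma continuous_spow_joint s u : 0 < s ->
  {for (s, u), continuous (fun p : R * R => spow p.1 p.2)}.
Proof.
move=> s0.
have pos v : 0 < v -> {for (s, v), continuous (fun p : R * R => spow p.1 p.2)}.
  move=> v0; rewrite /prop_for /continuous_at /= spow_gt0 // /powR gt_eqF //.
  apply: (@cvg_trans _ ((fun p : R * R => expR (p.1 * ln p.2)) @ (s, v))).
    apply: near_eq_cvg; near=> p.
    have p0 : 0 < p.2 by near: p; apply: (cvgr_gt v) => //; exact: cvg_snd.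
    by rewrite spow_gt0 // /powR gt_eqF.
  apply: (@cvg_comp _ _ _ (fun p : R * R => p.1 * ln p.2) expR _ (nbhs (s * ln v))).
    apply: cvgM; first exact: cvg_fst.
    have cl : {for (s, v), continuous (fun p : R * R => ln p.2)}.
      by apply: continuous_comp; [exact: cvg_snd|exact: continuous_ln].
    exact: cl.
  exact: continuous_expR.
have [u0|u0|->] := ltgtP u 0; [|exact: pos|].
  have cN : {for (s, u), continuous (fun p : R * R => (p.1, - p.2))}.
    by apply: (@cvg_pair _ _ _ _ (nbhs s) (nbhs (- u)));
      [exact: cvg_fst|apply: cvgN; exact: cvg_snd].
  have Nu0 : 0 < - u by rewrite oppr_gt0.
  have cneg := continuousN (continuous_comp cN (pos _ Nu0)).
  have e : (fun p : R * R => - spow p.1 (- p.2)) = (fun p => spow p.1 p.2).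
    by apply/funext => p; rewrite spowN opprK.
  by rewrite -e; exact: cneg.
apply/cvgrPdist_lt => e e0 /=.
(* The first coordinate is kept above s / 2, the second below the point where
   the power s / 2 reaches e. *)
have half0 : 0 < s / 2 by lra.
have d0 : 0 < Num.min 1 (e `^ (s / 2)^-1) by rewrite lt_min ltr01 powR_gt0.
have cs : (snd : R * R -> R) @ (s, 0) --> (0 : R) by exact: cvg_snd.
near=> p; rewrite spow0 sub0r normrN.
have p1 : s / 2 < p.1.
  by near: p; apply: (cvgr_gt s); [exact: cvg_fst|lra].
have p10 : 0 < p.1 by lra.
have p2 : `|p.2| < Num.min 1 (e `^ (s / 2)^-1).
  by rewrite -normrN -[- _]add0r; near: p; move/cvgrPdist_lt: cs; apply.
rewrite norm_spow ?gt_eqF //; have [->|p20] := eqVneq p.2 0.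
  by rewrite normr0 powR0 // gt_eqF.
move: p2; rewrite lt_min => /andP[p21 p2e].
have n0 : 0 < `|p.2| by rewrite normr_gt0.
apply: (@le_lt_trans _ _ (`|p.2| `^ (s / 2))).
  by apply: ger_powR; [rewrite n0 ltW|exact: ltW].
have ee : e = (e `^ (s / 2)^-1) `^ (s / 2).
  by rewrite -powRrM mulVf ?gt_eqF // powRr1 // ltW.
by rewrite [ltRHS]ee gt0_ltr_powR // nnegrE powR_ge0.
Unshelve. all: by end_near. Qed.

Lemma continuous_spow s : 0 < s -> continuous (spow s).
Proof.
move=> s0 u; apply: (@continuous_comp _ _ _ (fun u => (s, u)) (fun p => spow p.1 p.2)).
  by apply: (@cvg_pair _ _ _ _ (nbhs s) (nbhs u)); [exact: cvg_cst|exact: cvg_id].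
exact: continuous_spow_joint.
Qed.

End SignedPower.

(** * Conjugation by a power map at a fixed point *)

Section SingularConjugation.
Context {R : realType}.
Implicit Types (f : R -> R) (rho : bool -> R -> R) (a s t x y M : R).

(** The slope of f seen from a fixed point a, continuously extended by f'(a) at a.
    By the mean value theorem its values are values of f'. *)
Lemma fixed_point_quotient f a : c1diff f -> f a = a ->
  exists q : R -> R, [/\ continuous q, forall x, f x - a = q x * (x - a),
    q a = der f a &
    forall x, exists2 c, (0 <= a <= 1 -> 0 <= x <= 1 -> 0 <= c <= 1) &
      q x = der f c].
Proof.
move=> cf fa; have := c1_is_derive a cf.
move=> /is_derive1_caratheodory[q [qE cqa qa]]; rewrite fa in qE.
exists q; split=> // [x|x].
  have [->//|xa] := eqVneq x a.
  have xa0 : x - a != 0 by rewrite subr_eq0.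
  have ev : \forall z \near x, (f z - a) / (z - a) = q z.
    near=> z; rewrite qE mulfK // subr_eq0.
    have : (z < a) || (a < z).
      near: z; move: xa; rewrite neq_lt => /orP[h|h].
        by near=> z; apply/orP; left; near: z; exact: lt_nbhsl.
      by near=> z; apply/orP; right; near: z; exact: lt_nbhsr.
    by rewrite -neq_lt.
  rewrite /continuous_at -(nbhs_singleton ev).
  apply: (cvg_trans (near_eq_cvg ev)); apply: cvgM.
    by apply: cvgB; [exact: c1_continuous|exact: cvg_cst].
  by apply: cvgV => //; apply: cvgB; [exact: cvg_id|exact: cvg_cst].
have [->|xa] := eqVneq x a; first by exists a.
have [lo|hi] := leP x a.
  have [c cxa e] := c1_mvt cf lo; exists c; first by lra.
  have : q x * (x - a) = der f c * (x - a) by rewrite -qE; rewrite fa in e; lra.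
  by apply: mulIf; rewrite subr_eq0.
have [c cxa e] := c1_mvt cf (ltW hi); exists c; first by lra.
have : q x * (x - a) = der f c * (x - a) by rewrite -qE; rewrite fa in e; lra.
by apply: mulIf; rewrite subr_eq0.
Unshelve. all: by end_near. Qed.

(** power_at s a is the map x |-> sg(x - a) |x - a|^s, normalized by an affine map
    so as to fix 0 and 1; root_at s a is its inverse. *)
Definition power_scale s a := spow s (1 - a) + spow s a.
Definition power_at s a x := (spow s (x - a) + spow s a) / power_scale s a.
Definition root_at s a y := a + spow s^-1 (power_scale s a * y - spow s a).

Lemma power_scale_gt0 s a : 0 < s -> 0 <= a <= 1 -> 0 < power_scale s a.
Proof.
move=> s0 /andP[a0 a1]; rewrite /power_scale.
have sp_ge0 x : 0 <= x -> 0 <= spow s x by rewrite -{2}(spow0 s); exact: spow_le.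
have [->|an0] := eqVneq a 0; first by rewrite subr0 spow0 addr0 spow_gt0 ?powR_gt0.
have a0' : 0 < a by rewrite lt_neqAle eq_sym an0.
by rewrite ltr_wpDl ?sp_ge0 ?subr_ge0 // spow_gt0 // powR_gt0.
Qed.

Section FixedExponent.
Variables (s a : R).
Hypotheses (s0 : 0 < s) (a01 : 0 <= a <= 1).

Let D0 : 0 < power_scale s a. Proof. exact: power_scale_gt0. Qed.
Let sn0 : s != 0. Proof. by rewrite gt_eqF. Qed.

Let spowVK : cancel (spow s^-1) (@spow R s).
Proof. by move=> u; rewrite -{1}[s]invrK spowK // invr_eq0. Qed.

Lemma power_atK : cancel (power_at s a) (root_at s a).
Proof.
move=> x; rewrite /power_at /root_at mulrC divfK ?gt_eqF // addrK spowK //.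
by rewrite subrKC.
Qed.

Lemma root_atK : cancel (root_at s a) (power_at s a).
Proof.
move=> y; rewrite /power_at /root_at [a + _ - a]addrAC subrr add0r.
by rewrite spowVK subrK mulrC mulKf // gt_eqF.
Qed.

Lemma power_at_0 : power_at s a 0 = 0.
Proof. by rewrite /power_at sub0r spowN addNr mul0r. Qed.

Lemma power_at_1 : power_at s a 1 = 1.
Proof. by rewrite /power_at divff // gt_eqF. Qed.

Lemma power_at_01 x : 0 <= x <= 1 -> 0 <= power_at s a x <= 1.
Proof.
move=> /andP[x0 x1]; rewrite -{1}power_at_0 -{1}power_at_1 /power_at.
by rewrite !ler_pM2r ?invr_gt0 // !lerD2r !spow_le // ?lerD2r.
Qed.

Lemma root_at_01 y : 0 <= y <= 1 -> 0 <= root_at s a y <= 1.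
Proof.
have p0 : root_at s a 0 = 0 by rewrite -{1}power_at_0 power_atK.
have p1 : root_at s a 1 = 1 by rewrite -{1}power_at_1 power_atK.
move=> /andP[y0 y1]; rewrite -{1}p0 -{1}p1 /root_at.
by rewrite !lerD2l !spow_le ?invr_gt0 // lerD2r ler_pM2l.
Qed.

Lemma continuous_root_at : continuous (root_at s a).
Proof.
move=> y; apply: cvgD; first exact: cvg_cst.
apply: (@continuous_comp _ _ _ (fun y => power_scale s a * y - spow s a)).
  apply: cvgB; last exact: cvg_cst.
  by apply: cvgM; [exact: cvg_cst|exact: cvg_id].
by apply: continuous_spow; rewrite invr_gt0.
Qed.

(** Off a, the chain rule gives f' times ((f x - a) / (x - a))^(s - 1), and the
    quotient extends continuously to a.  At a the power map is singular, but the
    conjugate is multiplication of the centred variable by q^s, so its derivative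
    there is f'(a)^s: the conjugate is C^1 and the multiplier at a has been
    raised to the power s. *)
Lemma c1diff_conjugate_power_at f (q : R -> R) : c1diff f -> f a = a -> continuous q ->
    (forall x, f x - a = q x * (x - a)) -> q a = der f a -> (forall x, 0 < q x) ->
  c1diff (power_at s a \o f \o root_at s a) /\
  forall x, der (power_at s a \o f \o root_at s a) (power_at s a x) =
    der f x * expR ((s - 1) * ln (q x)).
Proof.
move=> cf fa cq qE qa q0.
pose dF x := der f x * expR ((s - 1) * ln (q x)).
have qpow x : expR ((s - 1) * ln (q x)) = q x `^ (s - 1) by rewrite /powR gt_eqF.
have isd y : is_derive y 1 (power_at s a \o f \o root_at s a) (dF (root_at s a y)).
  rewrite -{1}(root_atK y); set x := root_at s a y; rewrite /dF qpow.
  have [->|xa] := eqVneq x a.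
    rewrite -qa mulr_powRB1 // ?(ltW (q0 a)) //.
    apply/is_derive1_caratheodory.
    exists (fun w => q (root_at s a w) `^ s); split.
    + move=> w; rewrite /= power_atK fa.
      rewrite /power_at subrr spow0 add0r -mulrBl addrK qE spowM // {2}/root_at [a + _]addrC addrK.
      rewrite spowVK -mulrA; congr (_ * _).
      by rewrite mulrBl mulrC mulKf // gt_eqF.
    + rewrite (_ : (fun w => _) = fun w => expR (s * ln (q (root_at s a w)))); last first.
        by apply/funext => w; rewrite /powR gt_eqF.
      apply: (@continuous_comp _ _ _ (fun w => s * ln (q (root_at s a w)))); last exact: continuous_expR.
      apply: cvgM; first exact: cvg_cst.
      apply: (@continuous_comp _ _ _ (fun w => q (root_at s a w))); last exact: continuous_ln.
      by apply: continuous_comp; [exact: continuous_root_at|exact: cq].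
    + by rewrite /= power_atK.
  have u0 : x - a != 0 by rewrite subr_eq0.
  have fu0 : f x - a != 0 by rewrite qE mulf_neq0 // gt_eqF.
  have nu0 : 0 < `|x - a| by rewrite normr_gt0.
  have z0 : power_scale s a * power_at s a x - spow s a = spow s (x - a).
    by rewrite /power_at mulrC divfK ?gt_eqF // addrK.
  have zn0 : power_scale s a * power_at s a x - spow s a != 0.
    by rewrite z0 -normr_eq0 norm_spow // powR_eq0 normr_eq0 (negPf u0).
  have d1 : is_derive (power_at s a x) 1 (root_at s a)
      (s^-1 * `|spow s (x - a)| `^ (s^-1 - 1) * power_scale s a).
    have dl : is_derive (power_at s a x) 1 (fun y => power_scale s a * y - spow s a) (power_scale s a).
      by rewrite -[X in is_derive _ _ X _]/(power_scale s a \*: idfun - cst (spow s a));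
        apply: is_derive_eq; rewrite subr0 /GRing.scale /= mulr1.
    have ds := is_derive_spow s^-1 zn0.
    have dc := @is_derive1_comp _ (spow s^-1) (fun y => power_scale s a * y - spow s a) _ _ _ ds dl.
    rewrite z0 in dc.
    rewrite -[X in is_derive _ _ X _]/(cst a + (spow s^-1 \o (fun y => power_scale s a * y - spow s a))).
    by apply: is_derive_eq; rewrite add0r.
  have d2 : is_derive (f x) 1 (power_at s a) (s * `|f x - a| `^ (s - 1) / power_scale s a).
    have dl : is_derive (f x) 1 (fun y => y - a) 1.
      by rewrite -[X in is_derive _ _ X _]/(idfun - cst a); apply: is_derive_eq; rewrite subr0.
    have ds := is_derive_spow s fu0.
    have dc := @is_derive1_comp _ (spow s) (fun y => y - a) _ _ _ ds dl.
    rewrite mulr1 in dc.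
    rewrite (_ : power_at s a = (power_scale s a)^-1 \*: ((spow s \o (fun y => y - a)) + cst (spow s a))).
      by apply: is_derive_eq; rewrite addr0 /GRing.scale /= mulrC.
    by apply/funext => y'; rewrite /power_at mulrC.
  have df : is_derive (root_at s a (power_at s a x)) 1 f (der f x).
    by rewrite power_atK; exact: c1_is_derive.
  have d3 := @is_derive1_comp _ f (root_at s a) _ _ _ df d1.
  have d2' : is_derive ((f \o root_at s a) (power_at s a x)) 1 (power_at s a)
      (s * `|f x - a| `^ (s - 1) / power_scale s a) by rewrite /= power_atK.
  have d4 := @is_derive1_comp _ (power_at s a) (f \o root_at s a) _ _ _ d2' d3.
  apply: (is_derive_eq d4).
  rewrite qE normrM (gtr0_norm (q0 x)) norm_spow // -powRrM mulrBr mulr1 divff //.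
  rewrite powRM ?ltW //; have -> : 1 - s = - (s - 1) by lra.
  rewrite powRN; set A := q x `^ _; set B := `|x - a| `^ _.
  have B0 : B != 0 by rewrite gt_eqF // powR_gt0.
  have BB : B * B^-1 = 1 by rewrite divff.
  have ss : s * s^-1 = 1 by rewrite divff.
  have DD : power_scale s a * (power_scale s a)^-1 = 1 by rewrite divff ?gt_eqF.
  move: BB ss DD; move: (B^-1) (s^-1) ((power_scale s a)^-1) (der f x : R) => iB si iD d BB ss DD.
  have -> : s * (A * B) * iD * (d * (si * iB * power_scale s a)) =
    (d * A) * ((B * iB) * ((s * si) * (power_scale s a * iD))) by lra.
  by rewrite BB ss DD !mulr1.
have [cF dFE] : c1diff (power_at s a \o f \o root_at s a) /\
    der (power_at s a \o f \o root_at s a) = (fun y => dF (root_at s a y)).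
  apply: c1diff_of_is_derive => //.
  - move=> y; apply: (@continuous_comp _ _ _ (root_at s a) dF); first exact: continuous_root_at.
    apply: cvgM; first exact: c1_continuous_derive.
    apply: (@continuous_comp _ _ _ (fun x => (s - 1) * ln (q x)) expR); last exact: continuous_expR.
    apply: cvgM; first exact: cvg_cst.
    by apply: continuous_comp; [exact: cq|exact: continuous_ln].
  - by move=> y; rewrite mulr_gt0 ?c1_derive_gt0 // expR_gt0.
  - by rewrite /= -{1}power_at_0 power_atK (c1_fix0 cf) power_at_0.
  - by rewrite /= -{1}power_at_1 power_atK (c1_fix1 cf) power_at_1.
  - move=> y; have [x fx] := c1_surj cf (root_at s a y).
    by exists (power_at s a x); rewrite /= power_atK fx root_atK.
by split=> // x; rewrite dFE power_atK.
Qed.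

End FixedExponent.
End SingularConjugation.

(** * Lowering the multipliers; growth of iterates *)

Section PowerPath.
Context {R : realType}.
Implicit Types (f : R -> R) (rho : bool -> R -> R) (a s t x y M : R).

(** Letting the exponent decrease from 1 to s yields a path.  Along it the
    logarithm of the derivative is log f' + (sigma - 1) log q, where q is a value
    of f'; whence the factor 2. *)
Lemma joined_power M rho a s : commuting rho -> 0 <= a <= 1 ->
    (forall b, rho b a = a) -> 0 < s <= 1 -> (forall b, log_bound M (rho b)) ->
  joined (2 * M) rho (conjugate (power_at s a) (root_at s a) rho) /\
  forall b p, rho b p = p ->
    ln (der (conjugate (power_at s a) (root_at s a) rho b) (power_at s a p)) =
    (if p == a then s else 1) * ln (der (rho b) p).
Proof.
move=> crho a01 rhoa /andP[s0 s1] brho; have [c1rho _] := crho.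
have [q qP] := choice (fun b => fixed_point_quotient (c1rho b) (rhoa b)).
have q0 b x : 0 < q b x.
  by have [_ _ _ /(_ x)[c _ ->]] := qP b; exact: c1_derive_gt0.
have cF t b : 0 < t -> c1diff (conjugate (power_at t a) (root_at t a) rho b) /\
    forall x, der (conjugate (power_at t a) (root_at t a) rho b) (power_at t a x) =
      der (rho b) x * expR ((t - 1) * ln (q b x)).
  move=> t0; have [cq qE qa _] := qP b.
  by apply: (c1diff_conjugate_power_at t0 a01 (c1rho b) (rhoa b) cq qE qa (q0 b)).
split; last first.
  move=> b p bp; rewrite (proj2 (cF s b s0)) lnM ?posrE ?expR_gt0 ?c1_derive_gt0 //.
  rewrite expRK; have [_ qE qa _] := qP b.
  have [->|pa] := eqVneq p a; first by rewrite qa; lra.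
  have -> : q b p = 1.
    have : q b p * (p - a) = 1 * (p - a) by rewrite -qE bp mul1r.
    by apply: mulIf; rewrite subr_eq0.
  by rewrite ln1; lra.
pose sig t := 1 - t * (1 - s).
have sig0 t : 0 <= t <= 1 -> 0 < sig t /\ -1 <= sig t - 1 <= 0.
  by move=> /andP[t0 t1]; rewrite /sig; split; nra.
have csig x t : {for (t, x), continuous (fun p : R * R => sig p.1)}.
  apply: cvgB; first exact: cvg_cst.
  by apply: cvgM; [exact: cvg_fst|exact: cvg_cst].
pose Q b t x : R := der (rho b) x * expR ((sig t - 1) * ln (q b x)).
have e0 : conjugate (power_at (sig 0) a) (root_at (sig 0) a) rho = rho.
  have -> : sig 0 = 1 by rewrite /sig; lra.
  have p1 : power_at 1 a = idfun.
    by apply/funext => x; rewrite /power_at /power_scale !spow1 !subrK divr1.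
  have p2 : root_at 1 a = idfun.
    by apply/funext => x; have := @power_atK _ 1 a ltr01 a01 x; rewrite p1.
  by rewrite p1 p2.
have e1 : sig 1 = s by rewrite /sig; lra.
rewrite -[X in joined _ X]e0 -[in X in joined _ _ X]e1.
apply (@joined_conj_family R _ (fun t => power_at (sig t) a) (fun t => root_at (sig t) a) Q).
- exact: crho.
- by move=> t /sig0[st _]; split; [exact: power_atK|exact: root_atK].
- by move=> t x /sig0[st _] x01; split; [exact: power_at_01|exact: root_at_01].
- by move=> b t /sig0[st _]; exact: (proj1 (cF _ b st)).
- by move=> b t x /sig0[st _] _; exact: (proj2 (cF _ b st)).
- move=> b t x /sig0[st sig1] x01; have [_ _ _ /(_ x)[c c01 qc]] := qP b.
  have h1 := brho b x x01; have h2 := brho b c (c01 a01 x01).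
  have -> : Q b t x = expR (ln (der (rho b) x) + (sig t - 1) * ln (q b x)).
    by rewrite expRD lnK // posrE c1_derive_gt0.
  rewrite !ler_expR qc -ler_norml (le_trans (ler_normD _ _)) //.
  rewrite [2 * M]mulrDl mul1r lerD // normrM.
  have : `|sig t - 1| <= 1 by rewrite ler_norml; lra.
  have := normr_ge0 (ln (der (rho b) c)); move: h2.
  by move: `|ln (der (rho b) c)| `|sig t - 1| => u v; nra.
- move=> t t01; have [st _] := sig0 t t01.
  have cs (g : R * R -> R) x : {for (t, x), continuous g} ->
      {for (t, x), continuous (fun p => spow (sig p.1) (g p))}.
    move=> cg; apply: (@continuous_comp _ _ _ (fun p : R * R => (sig p.1, g p))
      (fun p : R * R => spow p.1 p.2)); last exact: continuous_spow_joint.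
    by apply: (@cvg_pair _ _ _ _ (nbhs (sig t)) (nbhs (g (t, x))));
      [exact: csig|exact: cg].
  apply: joint_unif_at => x x01; apply: cvgM; first apply: cvgD.
  + by apply: (cs (fun p => p.2 - a)); apply: cvgB; [exact: cvg_snd|exact: cvg_cst].
  + by apply: (cs (fun _ => a)); exact: cvg_cst.
  apply: cvgV; first by rewrite gt_eqF // power_scale_gt0.
  apply: cvgD.
  + by apply: (cs (fun p => 1 - a)); exact: cvg_cst.
  + by apply: (cs (fun _ => a)); exact: cvg_cst.
- move=> b t t01; have [cq _ _ _] := qP b; apply: joint_unif_at => x x01.
  apply: cvgM.
    by apply: continuous_comp; [exact: cvg_snd|exact: c1_continuous_derive].
  apply: (@continuous_comp _ _ _ (fun p : R * R => (sig p.1 - 1) * ln (q b p.2)) expR);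
    last exact: continuous_expR.
  apply: cvgM; first by apply: cvgB; [exact: csig|exact: cvg_cst].
  have c2 : {for (t, x), continuous (fun p : R * R => q b p.2)}.
    by apply: continuous_comp; [exact: cvg_snd|exact: cq].
  exact: (continuous_comp c2 (continuous_ln (q0 b x))).
Qed.

End PowerPath.

Section Growth.
Context {R : realType}.
Implicit Types (f : R -> R) (x y : R).

Lemma orbit_monotone f x n : c1diff f ->
  (x <= f x -> x <= iter n f x <= iter n.+1 f x) /\
  (f x <= x -> iter n.+1 f x <= iter n f x <= x).
Proof.
move=> cf; split=> fx.
  elim: n => [|n /andP[h1 h2]]; first by rewrite lexx.
  by rewrite (le_trans h1 h2) /= (c1_mono_le cf).
elim: n => [|n /andP[h1 h2]]; first by rewrite lexx andbT.
by rewrite (le_trans h1 h2) andbT /= (c1_mono_le cf).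
Qed.

(** Near fixed points |log f'| is below eta1, and away from them the displacement
    |f y - y| is bounded below. *)
Lemma log_derive_displacement f eta0 eta1 : c1diff f -> eta0 < eta1 ->
    (forall p, 0 <= p <= 1 -> f p = p -> `|ln (der f p)| <= eta0) ->
  exists K, forall y, 0 <= y <= 1 -> `|ln (der f y)| <= eta1 + K * `|f y - y|.
Proof.
move=> cf eta01 fixb.
have cln : continuous (fun y => `|ln (der f y)|).
  move=> y; apply: (@continuous_comp _ _ _ (fun y => ln (der f y)) Num.norm);
    last exact: norm_continuous.
  apply: continuous_comp; first exact: c1_continuous_derive.
  by apply: continuous_ln; exact: c1_derive_gt0.
have cdisp : continuous (fun y => `|f y - y|).
  move=> y; apply: (@continuous_comp _ _ _ (fun y => f y - y) Num.norm);
    last exact: norm_continuous.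
  by apply: cvgB; [exact: c1_continuous|exact: cvg_id].
have /compact_near_coveringP/near_covering_withinP cov := @segment_compact R 0 1.
have : \forall K \near +oo, `[0, 1] `<=`
    (fun y => `|ln (der f y)| <= eta1 + K * `|f y - y|).
  apply: (cov R (pinfty_nbhs R) (fun K y => `|ln (der f y)| <= eta1 + K * `|f y - y|)).
  move=> x; rewrite /= in_itv /= => x01.
  have [fx|fx] := eqVneq (f x) x.
    have h : \forall y \near x, `|ln (der f y)| < eta1.
      by apply: (cvgr_lt _ (cln x)); apply: le_lt_trans eta01; exact: fixb.
    exists ([set y | `|ln (der f y)| < eta1], [set K | 0 <= K]).
      by split=> //=; exact: nbhs_pinfty_ge.
    move=> [y K] [/= hy K0] _; rewrite (le_trans (ltW hy)) // lerDl.
    by rewrite mulr_ge0.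
  have d0 : 0 < `|f x - x| / 2 by rewrite divr_gt0 // normr_gt0 subr_eq0.
  have h1 : \forall y \near x, `|f x - x| / 2 < `|f y - y|.
    by apply: (cvgr_gt _ (cdisp x)); lra.
  pose L := `|ln (der f x)| + 1.
  have h2 : \forall y \near x, `|ln (der f y)| < L.
    by apply: (cvgr_lt _ (cln x)); rewrite /L; lra.
  have h3 : \forall K \near +oo, (L + `|eta1|) / (`|f x - x| / 2) <= K.
    by apply: nbhs_pinfty_ge; exact: num_real.
  exists ([set y | `|f x - x| / 2 < `|f y - y| /\ `|ln (der f y)| < L],
    [set K | (L + `|eta1|) / (`|f x - x| / 2) <= K]).
    by split=> /=; [exact: filterI|exact: h3].
  move=> [y K] [/= [hy1 hy2] hK] _.
  have L0 : 0 <= L + `|eta1| by rewrite /L addr_ge0 // addr_ge0.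
  have K0 : 0 <= K by apply: le_trans hK; rewrite divr_ge0 // ltW.
  rewrite ler_pdivrMr // in hK.
  have h4 : K * (`|f x - x| / 2) <= K * `|f y - y| by rewrite ler_wpM2l // ltW.
  have h5 := ler_norm (- eta1); rewrite normrN in h5.
  by rewrite (le_trans (ltW hy2)) //; lra.
move=> /filter_ex[K hK]; exists K => y y01; apply: hK.
by rewrite /= in_itv.
Qed.

(** Summing the previous bound along an orbit, the displacements add up to at most
    1 since the orbit is monotone in [0, 1].  Thus the exponential growth rate of
    (f^n)' is governed by the multipliers alone. *)
Lemma log_derive_iter f eta0 eta : c1diff f -> eta0 < eta ->
    (forall p, 0 <= p <= 1 -> f p = p -> `|ln (der f p)| <= eta0) ->
  exists n, forall x, 0 <= x <= 1 ->
    `|ln (der (iter n.+1 f) x)| <= n.+1%:R * eta.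
Proof.
move=> cf eta01 fixb; pose eta1 := (eta0 + eta) / 2.
have [|K0 hK0] := @log_derive_displacement f eta0 eta1 cf _ fixb.
  by rewrite /eta1; lra.
pose K := `|K0|.
have hK y : 0 <= y <= 1 -> `|ln (der f y)| <= eta1 + K * `|f y - y|.
  move=> y01; rewrite (le_trans (hK0 y y01)) // lerD2l ler_wpM2r //.
  exact: ler_norm.
have main n x : 0 <= x <= 1 ->
    `|ln (der (iter n f) x)| <= n%:R * eta1 + K * `|iter n f x - x|.
  move=> x01; elim: n => [|n IHn].
    by rewrite /= (proj2 c1diff_id) ln1 normr0 mul0r subrr normr0 mulr0 addr0.
  have cfn := c1diff_iter n cf.
  have -> : der (iter n.+1 f) x = der f (iter n f x) * der (iter n f) x.
    by rewrite -(der_comp _ cf cfn).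
  rewrite lnM ?posrE ?c1_derive_gt0 // (le_trans (ler_normD _ _)) //.
  have h := hK _ (c1_01 cfn x01).
  have -> : `|iter n.+1 f x - x| =
      `|f (iter n f x) - iter n f x| + `|iter n f x - x|.
    have [m1 m2] := orbit_monotone x n cf.
    move: m1 m2; rewrite -[iter n.+1 f x]/(f (iter n f x)).
    move: (iter n f x) (f (iter n f x)) => z w m1 m2.
    have [/m1/andP[h1 h2]|/ltW/m2/andP[h1 h2]] := leP x (f x).
      have [d1 d2 d3] : [/\ 0 <= w - x, 0 <= w - z & 0 <= z - x] by split; lra.
      by rewrite !ger0_norm //; lra.
    have [d1 d2 d3] : [/\ w - x <= 0, w - z <= 0 & z - x <= 0] by split; lra.
    by rewrite !ler0_norm //; lra.
  by rewrite -natr1; lra.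
pose n := Num.trunc (K / (eta - eta1)); exists n => x x01.
rewrite (le_trans (main _ _ x01)) //.
have e1 : 0 < eta - eta1 by rewrite /eta1; lra.
have : K / (eta - eta1) <= n.+1%:R by apply: ltW; exact: truncnS_gt.
rewrite ler_pdivrMr // => h.
have K00 : 0 <= K by exact: normr_ge0.
have : `|iter n.+1 f x - x| <= 1.
  have /andP[h1 h2] := c1_01 (c1diff_iter n.+1 cf) x01.
  by rewrite ler_norml; lra.
by move: `|iter n.+1 f x - x| => u u1; nra.
Qed.

End Growth.

(** * Reduction to small derivatives *)

Section Descent.
Context {R : realType}.
Implicit Types (f : R -> R) (rho : bool -> R -> R) (s : seq R) (M eta kappa : R).

(** The list s collects exceptional fixed points. *)
Definition multipliers_le kappa s rho := forall b p, 0 <= p <= 1 ->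
  rho b p = p -> p \notin s -> `|ln (der (rho b) p)| <= kappa.

Definition common_fixed s rho := forall p, p \in s ->
  0 <= p <= 1 /\ forall b, rho b p = p.

Definition c1_conjugate rho rho' := exists psi chi,
  [/\ c1diff psi, cancel psi chi, cancel chi psi & rho' = conjugate psi chi rho].

Lemma conj_fixed psi chi rho b p : cancel psi chi -> cancel chi psi ->
  conjugate psi chi rho b p = p -> rho b (chi p) = chi p.
Proof. by move=> pK cK; rewrite /conjugate /= => e; rewrite -{2}e pK. Qed.

(** At a fixed point the factors psi' in the derivative of the conjugate
    cancel. *)
Lemma der_conj_fixed psi chi rho b p : c1diff psi -> cancel psi chi ->
    cancel chi psi -> c1diff (rho b) -> conjugate psi chi rho b p = p ->
  der (conjugate psi chi rho b) p = der (rho b) (chi p).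
Proof.
move=> cpsi pK cK cb /(conj_fixed pK cK) e.
have [_ d] := c1diff_conj cpsi pK cK cb.
by rewrite -{1}(cK p) d e mulrAC divff ?mul1r // gt_eqF // c1_derive_gt0.
Qed.

Lemma multipliers_le_conj kappa s psi chi rho : c1diff psi -> cancel psi chi ->
    cancel chi psi -> commuting rho -> multipliers_le kappa s rho ->
  multipliers_le kappa (map psi s) (conjugate psi chi rho).
Proof.
move=> cpsi pK cK [crho _] ms b p p01 e pns.
have [cchi _] := c1diff_inverse cpsi pK cK.
rewrite (der_conj_fixed cpsi) //; apply: ms; first exact: c1_01.
  exact: conj_fixed pK cK e.
by apply: contra pns => /(map_f psi); rewrite cK.
Qed.

Lemma common_fixed_conj s psi chi rho : cancel psi chi ->
    (forall x, 0 <= x <= 1 -> 0 <= psi x <= 1) -> common_fixed s rho ->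
  common_fixed (map psi s) (conjugate psi chi rho).
Proof.
move=> pK psi01 fs _ /mapP[p /fs[p01 fp] ->]; split; first exact: psi01.
by move=> b; rewrite /conjugate /= pK fp.
Qed.

Lemma c1_conjugate_trans rho1 rho2 rho3 :
  c1_conjugate rho1 rho2 -> c1_conjugate rho2 rho3 -> c1_conjugate rho1 rho3.
Proof.
move=> [p [c [cp pK cK ->]]] [p' [c' [cp' pK' cK' ->]]].
exists (p' \o p), (c \o c'); split=> //; first exact: (proj1 (c1diff_comp cp' cp)).
- exact: can_comp.
- exact: can_comp.
Qed.

Lemma commuting_c1_conjugate rho rho' :
  commuting rho -> c1_conjugate rho rho' -> commuting rho'.
Proof.
move=> crho [p [c [cp pK cK ->]]]; apply: commuting_conj => // b.
by have [c1 _] := crho; case: (c1diff_conj cp pK cK (c1 b)).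
Qed.

Lemma log_boundP_der M f : c1diff f ->
  log_bound M f <-> der_le f (expR M) /\ der_ge f (expR (- M)).
Proof.
move=> cf; split=> [/(log_boundP _ cf) h|[h1 h2]].
  by split=> x /h /andP[].
by apply/log_boundP => // x x01; rewrite h1 // h2.
Qed.

Lemma average_path M rho b0 n c : 0 < c -> commuting rho ->
    (forall b, log_bound M (rho b)) ->
  exists rho', [/\ c1_conjugate rho rho', joined M rho rho',
    forall b k, der_le (rho b) k -> der_le (rho' b) k,
    forall b k, der_ge (rho b) k -> der_ge (rho' b) k &
    (der_le (iter n.+1 (rho b0)) (c ^+ n.+1) -> der_le (rho' b0) c) /\
    (der_ge (iter n.+1 (rho b0)) (c ^+ n.+1) -> der_ge (rho' b0) c)].
Proof.
move=> c0 crho brho.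
have [psi [chi [[cpsi pK cK] [hle hge h1 h2]]]] := average_step b0 n c0 crho.
have cc : c1_conjugate rho (conjugate psi chi rho) by exists psi, chi.
have [c1rho _] := crho; have [c1rho' _] := commuting_c1_conjugate crho cc.
exists (conjugate psi chi rho); split=> //.
apply: joined_conj => // b; apply/log_boundP_der => //.
by have [l1 l2] := (log_boundP_der M (c1rho b)).1 (brho b); split; auto.
Qed.

(** The end of the path is a C^1 conjugate that keeps all the bounds on the
    derivatives; such deformations may therefore be applied to the maps one after
    the other. *)
Definition reduces M rho rho' := [/\ c1_conjugate rho rho', joined M rho rho',
  forall b k, der_le (rho b) k -> der_le (rho' b) k &
  forall b k, der_ge (rho b) k -> der_ge (rho' b) k].

Lemma reduces_trans M rho1 rho2 rho3 :
  reduces M rho1 rho2 -> reduces M rho2 rho3 -> reduces M rho1 rho3.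
Proof.
move=> [c1 j1 l1 g1] [c2 j2 l2 g2]; split; last 2 first.
- by move=> b k /l1/l2.
- by move=> b k /g1/g2.
- exact: c1_conjugate_trans c2.
- exact: joined_trans j2.
Qed.

Lemma reduces_state M rho rho' : commuting rho -> (forall b, log_bound M (rho b)) ->
    reduces M rho rho' -> commuting rho' /\ forall b, log_bound M (rho' b).
Proof.
move=> crho brho [cc _ hl hg]; have crho' := commuting_c1_conjugate crho cc.
split=> // b; apply/log_boundP_der; first by case: crho'.
have [l1 l2] := (log_boundP_der M (proj1 crho b)).1 (brho b); split; auto.
Qed.

(** Two averages are needed: one along the iterates of rho b0 with ratio
    c = exp eta for the upper bound, then one with c = exp (- eta) for the lower
    bound, which keeps the upper one. *)
Lemma reduces_one M eta0 eta rho b0 : commuting rho ->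
    (forall b, log_bound M (rho b)) -> multipliers_le eta0 [::] rho ->
    eta0 < eta ->
  exists2 rho', reduces M rho rho' & log_bound eta (rho' b0).
Proof.
move=> crho brho mrho e01.
have multc rho' : c1_conjugate rho rho' -> multipliers_le eta0 [::] rho'.
  by move=> [p [c [cp pK cK ->]]]; exact: (multipliers_le_conj cp pK cK crho mrho).
have growth rho' : commuting rho' -> multipliers_le eta0 [::] rho' -> exists n,
    der_le (iter n.+1 (rho' b0)) (expR eta ^+ n.+1) /\
    der_ge (iter n.+1 (rho' b0)) (expR (- eta) ^+ n.+1).
  move=> [c1 _] m; have [|n hn] := log_derive_iter (c1 b0) e01.
    by move=> p p01 e; exact: m.
  exists n; rewrite -!expRM_natl mulrN.
  by apply/(log_boundP_der _ (c1diff_iter _ (c1 b0))).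
have [n [gle _]] := growth rho crho mrho.
have [rho1 [c1 j1 l1 g1 [u1 _]]] := average_path b0 n (expR_gt0 eta) crho brho.
have red1 : reduces M rho rho1 by [].
have [crho1 brho1] := reduces_state crho brho red1.
have [m [_ gge]] := growth rho1 crho1 (multc _ c1).
have [rho2 [c2 j2 l2 g2 [_ u2]]] := average_path b0 m (expR_gt0 (- eta)) crho1 brho1.
have red2 : reduces M rho1 rho2 by [].
have [[crho2 _] _] := reduces_state crho1 brho1 red2.
exists rho2; first exact: reduces_trans red2.
by apply/log_boundP_der => //; split; auto.
Qed.

Lemma reduces_all M eta0 eta rho : commuting rho ->
    (forall b, log_bound M (rho b)) -> multipliers_le eta0 [::] rho ->
    eta0 < eta ->
  exists2 rho', reduces M rho rho' & forall b, log_bound eta (rho' b).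
Proof.
move=> crho brho mrho e01.
have [rho1 r1 b1] := reduces_one true crho brho mrho e01.
have [crho1 brho1] := reduces_state crho brho r1.
have mrho1 : multipliers_le eta0 [::] rho1.
  have [[p [c [cp pK cK ->]]] _ _ _] := r1.
  exact: (multipliers_le_conj cp pK cK crho mrho).
have [rho2 r2 b2] := reduces_one false crho1 brho1 mrho1 e01.
have [crho2 _] := reduces_state crho1 brho1 r2.
exists rho2; first exact: reduces_trans r2.
case=> //; apply/log_boundP_der; first by case: crho2.
have [_ _ l2 g2] := r2.
by have [h1 h2] := (log_boundP_der eta (proj1 crho1 true)).1 b1; split; auto.
Qed.

(** The power map at one exceptional point doubles the bound on log-derivatives;
    averaging brings it back to 2 M before the next point is treated, so the
    bound along the path does not depend on the number of points. *)
Lemma flatten_multipliers M kappa rho s : 0 < kappa -> 0 < M -> commuting rho ->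
    (forall b, log_bound (2 * M) (rho b)) -> multipliers_le M [::] rho ->
    common_fixed s rho -> multipliers_le kappa s rho ->
  exists rho', [/\ commuting rho', joined (4 * M) rho rho',
    forall b, log_bound (2 * M) (rho' b) & multipliers_le kappa [::] rho'].
Proof.
move=> k0 M0; move: {2}(size s) (erefl (size s)) => n.
elim: n s rho => [|n IHn] [|a s] //= rho => [_|/succn_inj sn] crho brho mM fs mk.
  exists rho; split=> //; apply: joined_refl => // b x x01.
  by rewrite (le_trans (brho b x x01)) //; lra.
have [a01 rhoa] := fs a (mem_head _ _).
(* The multipliers being at most M in logarithm, this exponent brings those
   at a to at most kappa. *)
pose sg := Num.min 1 (kappa / M).
have sg01 : 0 < sg <= 1 by rewrite /sg lt_min ltr01 divr_gt0 //= ge_min lexx.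
have sgM : sg * M <= kappa.
  by rewrite -ler_pdivlMr // /sg ge_min lexx orbT.
have [j1 mult1] := joined_power crho a01 rhoa sg01 brho.
have [sg0 sg1] := andP sg01.
set rho1 := conjugate _ _ rho in j1 mult1.
have pK := power_atK sg0 a01; have cK := root_atK sg0 a01.
have [crho1 brho1] : commuting rho1 /\ forall b, log_bound (4 * M) (rho1 b).
  have [g [_ g1 gc _] gb] := j1.
  rewrite -(g1 1) //; split=> // b x x01; rewrite (le_trans (gb 1 b x x01)) //; lra.
have fixed1 b p : rho1 b p = p -> rho b (root_at sg a p) = root_at sg a p.
  exact: conj_fixed pK cK.
have mM1 : multipliers_le M [::] rho1.
  move=> b p p01 e _; have e' := fixed1 b p e.
  have := mM b _ (root_at_01 sg0 a01 p01) e' isT.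
  rewrite -{2}(cK p) mult1 // normrM.
  have : `|if root_at sg a p == a then sg else 1| <= 1.
    by case: ifP => _; rewrite ger0_norm // ltW.
  have := normr_ge0 (ln (der (rho b) (root_at sg a p))).
  by move: `|ln _| `|if _ then _ else _| => u v; nra.
have mk1 : multipliers_le kappa (map (power_at sg a) s) rho1.
  move=> b p p01 e pns; have e' := fixed1 b p e.
  have q01 := root_at_01 sg0 a01 p01.
  rewrite -(cK p) mult1 // normrM; have [pa|pa] := eqVneq (root_at sg a p) a.
    rewrite ger0_norm ?(ltW sg0) // (le_trans _ sgM) // ler_wpM2l ?(ltW sg0) //.
    exact: mM.
  rewrite normr1 mul1r; apply: mk => //; rewrite inE (negPf pa) /=.
  by apply: contra pns => /(map_f (power_at sg a)); rewrite cK.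
have fs1 : common_fixed (map (power_at sg a) s) rho1.
  apply: common_fixed_conj => //; first exact: power_at_01.
  by move=> p ps; apply: fs; rewrite inE ps orbT.
have M2 : M < 2 * M by lra.
have [rho2 r2 b2] := reduces_all crho1 brho1 mM1 M2.
have [crho2 _] := reduces_state crho1 brho1 r2.
have [[psi [chi [cpsi pK2 cK2 rho2E]]] j2 _ _] := r2.
have mM2 : multipliers_le M [::] rho2.
  by rewrite rho2E; exact: (multipliers_le_conj cpsi pK2 cK2 crho1 mM1).
have mk2 : multipliers_le kappa (map psi (map (power_at sg a) s)) rho2.
  by rewrite rho2E; exact: multipliers_le_conj.
have fs2 : common_fixed (map psi (map (power_at sg a) s)) rho2.
  by rewrite rho2E; apply: common_fixed_conj => // x; exact: c1_01.
have [|rho3 [crho3 j3 b3 m3]] := IHn _ _ _ crho2 b2 mM2 fs2 mk2.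
  by rewrite !size_map.
exists rho3; split=> //.
apply: joined_trans j3; apply: joined_trans j2.
by move: j1; rewrite (_ : 2 * (2 * M) = 4 * M) //; lra.
Qed.

End Descent.

(** * Hyperbolic fixed points and the path to the identity *)

Section ToIdentity.
Context {R : realType}.
Implicit Types (f g : R -> R) (rho : bool -> R -> R) (M kappa d x y p : R).

(** Between two fixed points f' takes the value 1, hence log f' the value 0. *)
Lemma hyperbolic_separated f kappa : c1diff f -> 0 < kappa ->
  exists2 d, 0 < d & forall x y, 0 <= x <= 1 -> f x = x -> f y = y -> x != y ->
    kappa <= `|ln (der f x)| -> d <= `|y - x|.
Proof.
move=> cf k0.
have cln : continuous (fun x => ln (der f x)).
  move=> x; apply: continuous_comp; first exact: c1_continuous_derive.
  by apply: continuous_ln; exact: c1_derive_gt0.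
have [d d0 hd] := unif_continuous01 cln k0; exists d => // x y x01 fx fy xy kx.
rewrite leNgt; apply/negP => yx.
have [z [zx dz]] : exists z, `|z - x| <= `|y - x| /\ der f z = 1.
  have [lo|hi] := leP x y.
    have [z zxy e] := c1_mvt cf lo; exists z; split.
      by rewrite !ger0_norm; lra.
    have : der f z * (y - x) = 1 * (y - x) by rewrite -e fx fy mul1r.
    by apply: mulIf; rewrite subr_eq0 eq_sym.
  have [z zxy e] := c1_mvt cf (ltW hi); exists z; split.
    by rewrite !ler0_norm; lra.
  have : der f z * (x - y) = 1 * (x - y) by rewrite -e fx fy mul1r.
  by apply: mulIf; rewrite subr_eq0.
have := hd x z x01 (le_lt_trans zx yx); rewrite dz ln1 sub0r normrN.
by rewrite ltNge kx.
Qed.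

(** Each cell [i d, (i + 1) d[ contains at most one point of A. *)
Lemma separated_finite (A : set R) d : 0 < d -> (forall x, A x -> 0 <= x <= 1) ->
    (forall x y, A x -> A y -> x != y -> d <= `|y - x|) ->
  exists s : seq R, forall x, A x <-> x \in s.
Proof.
move=> d0 A01 Asep.
pose cell i : set R := A `&` [set x | Num.trunc (x / d) = i].
(* xget selects the point of A in a cell; its default value 0, for the cells
   that do not meet A, is removed by the filter unless it lies in A. *)
pose s0 := [seq xget 0 (cell i) | i <- iota 0 (Num.trunc (1 / d)).+1].
exists [seq x <- s0 | `[< A x >]] => x; rewrite mem_filter; split; last first.
  by move=> /andP[/asboolP].
move=> Ax; apply/andP; split; first exact/asboolP.
have /andP[x0 x1] := A01 x Ax.
apply/mapP; exists (Num.trunc (x / d)).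
  by rewrite mem_iota ltnS le_truncn // ler_pM2r ?invr_gt0.
have cx : cell (Num.trunc (x / d)) x by [].
have [] : cell (Num.trunc (x / d)) (xget 0 (cell (Num.trunc (x / d)))).
  exact: xgetPex (ex_intro _ x cx).
move: (xget _ _) => y Ay /= yx.
apply/eqP; apply: contraT => xy.
have := Asep x y Ax Ay xy; apply: contraLR => _; rewrite -ltNge.
have /andP[y0 _] := A01 y Ay.
have /andP[hx1 hx2] := truncn_itv (divr_ge0 x0 (ltW d0)).
have /andP[hy1 hy2] := truncn_itv (divr_ge0 y0 (ltW d0)).
rewrite yx in hy1 hy2; rewrite -natr1 in hx2 hy2.
have : `|y / d - x / d| < 1 by rewrite ltr_norml; lra.
by rewrite -mulrBl normrM [`|d^-1|]gtr0_norm ?invr_gt0 // ltr_pdivrMr // mul1r.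
Qed.

(** If g moved p, the points g^n p would all be fixed by f with the same multiplier
    as p.  They would then be d-separated along a monotone orbit in [0, 1], which
    is absurd. *)
Lemma hyperbolic_common_fixed rho kappa b p : commuting rho -> 0 < kappa ->
    0 <= p <= 1 -> rho b p = p -> kappa < `|ln (der (rho b) p)| ->
  forall b', rho b' p = p.
Proof.
move=> [c1 crho] k0 p01 bp kp b'; apply/eqP; apply: contraT => gp.
set f := rho b in bp kp; set g := rho b' in gp.
have [cf cg] : c1diff f /\ c1diff g by split; exact: c1.
have fg x : f (g x) = g (f x) by exact: crho.
have fix_orbit n : f (iter n g p) = iter n g p /\
    der f (iter n g p) = der f p.
  elim: n => [//|n [fn dn]] /=; split; first by rewrite fg fn.
  have : der f (g (iter n g p)) * der g (iter n g p) =
      der f p * der g (iter n g p).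
    rewrite -(der_comp _ cf cg) (_ : (fun x => f (g x)) = (fun x => g (f x))).
      by rewrite (der_comp _ cg cf) fn dn mulrC.
    by apply/funext => x; rewrite fg.
  by apply: mulIf; rewrite gt_eqF // c1_derive_gt0.
have [d d0 sep] := hyperbolic_separated cf k0.
have mov n : iter n g p != iter n.+1 g p.
  elim: n => [|n IHn]; first by rewrite eq_sym.
  by apply: contra IHn => /eqP/(c1_inj cg)/eqP.
have step n : d <= `|iter n.+1 g p - iter n g p|.
  have kn : kappa <= `|ln (der f (iter n g p))| by rewrite (proj2 (fix_orbit n)) ltW.
  have n01 := c1_01 (c1diff_iter n cg) p01.
  exact: (sep _ _ n01 (proj1 (fix_orbit n)) (proj1 (fix_orbit n.+1)) (mov n) kn).
(* The orbit is monotone, so its successive gaps add up. *)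
have far n : n%:R * d <= `|iter n g p - p|.
  elim: n => [|n IHn]; first by rewrite mul0r.
  have := step n; have [m1 m2] := orbit_monotone p n cg.
  move: m1 m2 IHn; rewrite -natr1 -[iter n.+1 g p]/(g (iter n g p)).
  move: (iter n g p) (g (iter n g p)) => z w m1 m2 IHn st.
  clear -m1 m2 IHn st.
  have [/m1/andP[h1 h2]|/ltW/m2/andP[h1 h2]] := leP p (g p).
    have [d1 d2 d3] : [/\ 0 <= w - p, 0 <= w - z & 0 <= z - p] by split; lra.
    by move: IHn st; rewrite !ger0_norm //; lra.
  have [d1 d2 d3] : [/\ w - p <= 0, w - z <= 0 & z - p <= 0] by split; lra.
  by move: IHn st; rewrite !ler0_norm //; lra.
pose n := (Num.trunc (1 / d)).+1.
have : 1 / d < n%:R by exact: truncnS_gt.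
rewrite ltr_pdivrMr // => h1; have h2 := far n.
have /andP[h3 h4] := c1_01 (c1diff_iter n cg) p01.
have : `|iter n g p - p| <= 1 by rewrite ler_norml; lra.
by move=> h5; have := lt_le_trans h1 (le_trans h2 h5); rewrite ltxx.
Qed.

Lemma hyperbolic_finite rho kappa : commuting rho -> 0 < kappa ->
  exists s, common_fixed s rho /\ multipliers_le kappa s rho.
Proof.
move=> crho k0; have [c1 _] := crho.
pose A := [set p : R | 0 <= p <= 1 /\
  exists b, rho b p = p /\ kappa < `|ln (der (rho b) p)|].
have Afix p : A p -> forall b, rho b p = p.
  by move=> [p01 [b [bp kp]]]; exact: hyperbolic_common_fixed kp.
have [d1 d10 sep1] := hyperbolic_separated (c1 true) k0.
have [d2 d20 sep2] := hyperbolic_separated (c1 false) k0.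
have [|||s sA] := @separated_finite A (Num.min d1 d2).
- by rewrite lt_min d10.
- by move=> x [].
- move=> x y Ax Ay xy; have [x01 [b [bx /ltW kx]]] := Ax.
  have by' := Afix y Ay b; rewrite ge_min; case: b bx by' kx => bx by' kx.
    by rewrite sep1.
  by rewrite sep2 ?orbT.
exists s; split=> [p /sA Ap|b p p01 bp pns].
  by split; [case: Ap|exact: Afix].
rewrite leNgt; apply: contra pns => kp; apply/sA; split=> //.
by exists b.
Qed.

(** Log-multipliers up to M / 4 allow averaging down to M / 2.  The finitely many
    fixed points with larger ones are treated first, by power maps. *)
Lemma halve_log_bound rho M : commuting rho -> 0 < M ->
    (forall b, log_bound M (rho b)) ->
  exists rho', [/\ commuting rho', joined (4 * M) rho rho' &
    forall b, log_bound (M / 2) (rho' b)].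
Proof.
move=> crho M0 brho; have k0 : 0 < M / 4 by lra.
have [s [fs ms]] := hyperbolic_finite crho k0.
have b2 b : log_bound (2 * M) (rho b).
  by move=> x x01; rewrite (le_trans (brho b x x01)) //; lra.
have mM : multipliers_le M [::] rho by move=> b p p01 _ _; exact: brho.
have [rho1 [crho1 j1 b1 m1]] := flatten_multipliers k0 M0 crho b2 mM fs ms.
have b1' b : log_bound (4 * M) (rho1 b).
  by move=> x x01; rewrite (le_trans (b1 b x x01)) //; lra.
have lt42 : M / 4 < M / 2 by lra.
have [rho2 r2 b3] := reduces_all crho1 b1' m1 lt42.
exists rho2; split=> //; first by case: (reduces_state crho1 b1' r2).
by case: r2 => _ j2 _ _; exact: joined_trans j2.
Qed.

(** Iterated halving gives pairs of size at most (M1 + M2) / 2^n, and the paths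
    joining them are concatenated. *)
Lemma path_to_identity rho : commuting rho ->
  exists gamma, is_path gamma rho (fun=> idfun).
Proof.
move=> crho; have [c1 _] := crho.
have cln b : continuous (fun x => ln (der (rho b) x)).
  move=> x; apply: continuous_comp; first exact: c1_continuous_derive.
  by apply: continuous_ln; exact: c1_derive_gt0.
have [M1 M10 h1] := continuous01_bounded (cln true).
have [M2 M20 h2] := continuous01_bounded (cln false).
pose good (x : (bool -> R -> R) * R) := [/\ commuting x.1, 0 < x.2 &
  forall b, log_bound x.2 (x.1 b)].
have g0 : good (rho, M1 + M2).
  split=> //=; first by rewrite addr_gt0.
  by case=> x x01; [rewrite (le_trans (h1 x x01))|rewrite (le_trans (h2 x x01))];
    rewrite // ?lerDl ?lerDr ltW.
have next (x : {x | good x}) : exists y : {x | good x},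
    (sval y).2 = (sval x).2 / 2 /\ joined (4 * (sval x).2) (sval x).1 (sval y).1.
  case: x => -[r M] [/= cr M0 br]; have [r' [cr' j b']] := halve_log_bound cr M0 br.
  have g' : good (r', M / 2) by split=> //=; rewrite divr_gt0.
  by exists (exist _ _ g').
have [nx nxP] := choice next; pose x n := iter n nx (exist _ _ g0).
have xM n : (sval (x n)).2 = (M1 + M2) / 2 ^+ n.
  elim: n => [|n IHn]; first by rewrite expr0 divr1.
  by rewrite /x /= (proj1 (nxP _)) -/(x n) IHn exprSr invfM mulrA.

apply: (@joined_limit R (fun n => (sval (x n)).1) (fun n => 4 * (sval (x n)).2)).
- by move=> n; exact: (proj2 (nxP (x n))).
- move=> n; have [_ Mn _] := svalP (x n); rewrite /x /= (proj1 (nxP _)) -/(x n).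
  lra.
- move=> e e0; have e4 : 0 < e / 4 by lra.
  pose n := (Num.trunc ((M1 + M2) / (e / 4))).+1; exists n.
  have n2 : n%:R <= 2 ^+ n :> R by rewrite -natrX ler_nat ltnW // ltn_expl.
  have : (M1 + M2) / (e / 4) < n%:R by exact: truncnS_gt.
  rewrite xM ltr_pdivrMr // => h.
  have : (M1 + M2) / 2 ^+ n < e / 4.
    by rewrite ltr_pdivrMr ?exprn_gt0 // (lt_le_trans h) // mulrC ler_pM2l.
  lra.
Qed.

End ToIdentity.

(** * Differentiation on the subtype [0, 1] *)

Section UnitInterval.
Context {R : realType}.
Implicit Types (u : I01 R -> R) (x y z : I01 R) (F : R -> R) (t l e d : R).

Lemma I01_bounds x : 0 <= I01_val x <= 1.
Proof. by have := set_valP x; rewrite /= in_itv. Qed.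

Lemma mem_clamp t : clamp t \in (`[0, 1]%classic : set R).
Proof. by rewrite inE /= in_itv /=; exact: clamp01. Qed.

Definition proj01 t : I01 R := SigSub (mem_clamp t).

Lemma proj01_val t : I01_val (proj01 t) = clamp t.
Proof. by []. Qed.

Lemma I01_val_inj : injective (@I01_val R).
Proof. exact: val_inj. Qed.

Lemma val_proj01 t : 0 <= t <= 1 -> I01_val (proj01 t) = t.
Proof. by move=> t01; rewrite proj01_val clamp_id. Qed.

Lemma proj01K x : proj01 (I01_val x) = x.
Proof. by apply: I01_val_inj; rewrite val_proj01 // I01_bounds. Qed.

Lemma nbhs_I01P x (A : set (I01 R)) : nbhs x A <->
  exists2 d, 0 < d & forall y, `|I01_val y - I01_val x| < d -> A y.
Proof.
split.
  move=> [B [[W oW <-] /= Wx] WA].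
  have /nbhs_ballP[d /= d0 hd] : nbhs (I01_val x) W by exact: open_nbhs_nbhs.
  exists d => // y yx; apply: WA; apply: hd.
  by rewrite /ball /= distrC.
move=> [d d0 hd].
have : nbhs x (@I01_val R @^-1` ball (I01_val x) d).
  apply: (@initial_continuous _ _ (@I01_val R) x); exact: nbhsx_ballx.
by apply: filterS => y; rewrite /ball /= distrC => /hd.
Qed.

Lemma continuous_I01_val : continuous (@I01_val R).
Proof. exact: initial_continuous. Qed.

Lemma continuous_proj01 : continuous proj01.
Proof.
move=> t A /nbhs_I01P[d d0 hd].
have /cvgrPdist_lt/(_ d d0) := @continuous_clamp R t.
by apply: filterS => s hs; apply: hd; rewrite distrC.
Qed.

Lemma dnbhs_I01P x (A : set (I01 R)) : x^' A <->
  exists2 d, 0 < d & forall y, `|I01_val y - I01_val x| < d -> y != x -> A y.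
Proof. by rewrite /dnbhs /within /=; exact: nbhs_I01P. Qed.

Lemma I01_close_point x d : 0 < d ->
  exists2 y, `|I01_val y - I01_val x| < d & y != x.
Proof.
move=> d0; pose s := Num.min (d / 2) (1 / 2).
have s0 : 0 < s by rewrite lt_min; lra.
have sd : s <= d / 2 by rewrite ge_min lexx.
have s1 : s <= 1 / 2 by rewrite ge_min lexx orbT.
have x01 := I01_bounds x.
have [t t01 tx] : exists2 t, 0 <= t <= 1 & `|t - I01_val x| = s.
  have [h|h] := leP (I01_val x) (1 / 2).
    by exists (I01_val x + s); [lra|rewrite addrAC subrr add0r gtr0_norm].
  exists (I01_val x - s); first lra.
  by rewrite addrAC subrr add0r normrN gtr0_norm.
exists (proj01 t); first by rewrite val_proj01 // tx; lra.
apply/eqP => e; have := tx; rewrite -[t]val_proj01 // e subrr normr0; lra.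
Qed.

Lemma dnbhs_I01_proper x : ProperFilter x^'.
Proof.
split; last exact: dnbhs_filter.
move=> /dnbhs_I01P[d d0 h]; have [y yx ynx] := I01_close_point x d0.
exact: (h y).
Qed.

(** First-order expansion: equivalent to the convergence of difference quotients,
    but free of punctured neighbourhoods. *)
Definition expands u x l := forall e, 0 < e -> exists2 d, 0 < d &
  forall y, `|I01_val y - I01_val x| < d ->
  `|u y - u x - l * (I01_val y - I01_val x)| <= e * `|I01_val y - I01_val x|.

Lemma expands_quotient u x l :
  expands u x l <-> diff_quotient u x y @[y --> x^'] --> l.
Proof.
have eq_quot y : y != x -> u y - u x - l * (I01_val y - I01_val x) =
    (diff_quotient u x y - l) * (I01_val y - I01_val x).
  move=> yx; rewrite mulrBl /diff_quotient divfK // subr_eq0.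
  by apply: contra yx => /eqP/I01_val_inj->.
split=> [ex|/cvgrPdist_le cq e /cq/dnbhs_I01P[d d0 h]].
  apply/cvgrPdist_le => e /ex[d d0 h]; apply/dnbhs_I01P; exists d => // y yx ynx.
  have : 0 < `|I01_val y - I01_val x|.
    rewrite normr_gt0 subr_eq0; apply: contra ynx => /eqP/I01_val_inj->//.
  move=> n0; have := h y yx; rewrite eq_quot // normrM ler_pM2r //.
  by rewrite distrC.
exists d => // y yx; have [->|ynx] := eqVneq y x.
  by rewrite !subrr mulr0 subrr normr0 mulr0.
by rewrite eq_quot // normrM ler_wpM2r // distrC; exact: h.
Qed.

Lemma derivable01_expands u x : derivable01 u x -> expands u x (deriv01 u x).
Proof. by move=> du; apply/expands_quotient. Qed.

Lemma expands_derivable01 u x l : expands u x l ->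
  derivable01 u x /\ deriv01 u x = l.
Proof.
move=> /expands_quotient cq; have := dnbhs_I01_proper x => pf.
by split; [apply/cvg_ex; exists l|exact: cvg_lim cq].
Qed.

Lemma is_derive_expands F t l :
  (forall e, 0 < e -> exists2 d, 0 < d & forall s, `|s - t| < d ->
    `|F s - F t - l * (s - t)| <= e * `|s - t|) <-> is_derive t 1 F l.
Proof.
split=> [ex|/is_derive1_caratheodory[g [gE cg gt]] e e0].
  apply/is_derive1_caratheodory.
  exists (fun s => if s == t then l else (F s - F t) / (s - t)); split.
  - move=> s; case: eqP => [->|/eqP st]; first by rewrite !subrr mulr0.
    by rewrite divfK // subr_eq0.
  - apply/cvgrPdist_le => e e0; have [d d0 h] := ex e e0.
    rewrite eqxx; apply/nbhs_ballP.
    exists d => // s; rewrite /ball /= distrC => /h hs.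
    case: eqP => [_|/eqP st]; first by rewrite subrr normr0 ltW.
    have n0 : 0 < `|s - t| by rewrite normr_gt0 subr_eq0.
    rewrite -(ler_pM2r n0) -normrM mulrBl divfK ?subr_eq0 // distrC.
    exact: hs.
  - by rewrite eqxx.
have /cvgrPdist_le/(_ e e0)/nbhs_ballP[d /= d0 h] := cg.
exists d => // s st; rewrite gE -mulrBl normrM ler_wpM2r // -gt distrC.
by apply: h; rewrite /ball /= distrC.
Qed.

End UnitInterval.

(** * Linear extension of a diffeomorphism of [0, 1] to the line *)

Section Extension.
Context {R : realType}.
Implicit Types (f g h : I01 R -> I01 R) (x y : I01 R) (t s e : R).

Definition c1expands f (df : I01 R -> R) :=
  (forall x, expands (@I01_val R \o f) x (df x)) /\ continuous df.

Lemma class_C_c1expands r f : order_le 1 r -> class_C r (@I01_val R \o f) ->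
  c1expands f (deriv01 (@I01_val R \o f)).
Proof.
move=> r1 [der_f cont_f]; split=> [x|]; last exact: (cont_f 1%N r1).
by apply: derivable01_expands; exact: (der_f 0%N r1).
Qed.

Lemma I01_homo_le f : {homo f : x y / I01_val x < I01_val y} ->
  {homo f : x y / I01_val x <= I01_val y}.
Proof.
move=> hf x y; rewrite le_eqVlt => /predU1P[/I01_val_inj->//|/hf].
exact: ltW.
Qed.

(** If f' x <= 0, then, f being increasing, |f y - f x| is negligible with respect
    to |y - x| near x, whereas the inverse of f, being differentiable at f x,
    expands lengths by a bounded factor only. *)
Lemma c1expands_gt0 f g df dg x : cancel f g -> c1expands f df ->
  c1expands g dg -> {homo f : x y / I01_val x < I01_val y} -> 0 < df x.
Proof.
move=> fK [ef _] [eg _] hf; rewrite ltNge; apply/negP => df0.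
(* Near f x the map g expands by at most k; the contradiction comes from f
   contracting by 1 / (2 k) near x. *)
pose k := `|dg (f x)| + 1.
have k0 : 0 < k by rewrite /k ltr_wpDl.
have [d1 d10 h1] := eg (f x) 1 ltr01.
have e0 : 0 < (2 * k)^-1 by rewrite invr_gt0 mulr_gt0.
have [d2 d20 h2] := ef x _ e0.
have cf : \forall y \near x, `|I01_val (f y) - I01_val (f x)| < d1.
  have [d3 d30 h3] := ef x 1 ltr01; apply/nbhs_I01P.
  pose c := `|df x| + 1.
  have c0 : 0 < c by rewrite /c ltr_wpDl.
  exists (Num.min d3 (d1 / c)) => [|y]; first by rewrite lt_min d30 divr_gt0.
  rewrite lt_min ltr_pdivlMr // => /andP[/h3 /= h yx].
  apply: le_lt_trans yx; have := ler_normD (I01_val (f y) - I01_val (f x) - df x *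
    (I01_val y - I01_val x)) (df x * (I01_val y - I01_val x)).
  rewrite subrK normrM /c; lra.
have /nbhs_I01P[d3 d30 h3] := cf.
have d23 : 0 < Num.min d2 d3 by rewrite lt_min d20.
have [y yx ynx] := I01_close_point x d23.
have {yx} [yx2 yx3] : `|I01_val y - I01_val x| < d2 /\ `|I01_val y - I01_val x| < d3.
  by apply/andP; rewrite -lt_min.
have a1 := h2 y yx2; have a2 := h1 (f y) (h3 y yx3).
rewrite /= !fK in a2; rewrite /= in a1.
have w0 : 0 < `|I01_val y - I01_val x|.
  by rewrite normr_gt0 subr_eq0; apply: contra ynx => /eqP/I01_val_inj->.
have {a2} a2 : `|I01_val y - I01_val x| <= k * `|I01_val (f y) - I01_val (f x)|.
  have := ler_normD (I01_val y - I01_val x - dg (f x) *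
    (I01_val (f y) - I01_val (f x))) (dg (f x) * (I01_val (f y) - I01_val (f x))).
  rewrite subrK normrM /k; lra.
have {a1} a1 : `|I01_val (f y) - I01_val (f x)| <=
    (2 * k)^-1 * `|I01_val y - I01_val x|.
  apply: le_trans a1; have [lt|lt|/I01_val_inj e] := ltgtP (I01_val x) (I01_val y).
  - have := hf _ _ lt; move: (df x) df0 (I01_val x) (I01_val y) lt => d dle a b ab.
    move: (I01_val (f x)) (I01_val (f y)) => a' b' ab'.
    by rewrite !ger0_norm; nra.
  - have := hf _ _ lt; move: (df x) df0 (I01_val x) (I01_val y) lt => d dle a b ab.
    move: (I01_val (f x)) (I01_val (f y)) => a' b' ab'.
    by rewrite !ler0_norm; nra.
  - by rewrite e eqxx in ynx.
have : k * `|I01_val (f y) - I01_val (f x)| <= `|I01_val y - I01_val x| / 2.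
  rewrite -ler_pdivlMl // (le_trans a1) // invfM; lra.
lra.
Qed.

Variables (f g : I01 R -> I01 R) (df dg : I01 R -> R).
Hypotheses (fK : cancel f g) (gK : cancel g f) (ef : c1expands f df).
Hypotheses (df0 : forall x, 0 < df x).
Hypothesis hf : {homo f : x y / I01_val x < I01_val y}.

(** Affine continuation with the one-sided slopes at the endpoints. *)
Definition extend (t : R) : R :=
  if t < 0 then df (I01_0 R) * t
  else if 1 < t then 1 + df (I01_1 R) * (t - 1) else I01_val (f (proj01 t)).

Lemma extend01 x : extend (I01_val x) = I01_val (f x).
Proof.
have /andP[x0 x1] := I01_bounds x.
by rewrite /extend ltNge x0 ltNge x1 /= proj01K.
Qed.

Lemma homeo_I01_0 : f (I01_0 R) = I01_0 R.
Proof.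
apply: I01_val_inj; apply/le_anti/andP; split.
  have /andP[h _] := I01_bounds (g (I01_0 R)).
  by have := I01_homo_le hf (h : I01_val (I01_0 R) <= _); rewrite gK.
by have /andP[] := I01_bounds (f (I01_0 R)).
Qed.

Lemma homeo_I01_1 : f (I01_1 R) = I01_1 R.
Proof.
apply: I01_val_inj; apply/le_anti/andP; split.
  by have /andP[] := I01_bounds (f (I01_1 R)).
have /andP[_ h] := I01_bounds (g (I01_1 R)).
by have := I01_homo_le hf (h : _ <= I01_val (I01_1 R)); rewrite gK.
Qed.

Lemma extend_lt0 t : t < 0 -> extend t = df (I01_0 R) * t.
Proof. by rewrite /extend => ->. Qed.

Lemma extend_gt1 t : 1 < t -> extend t = 1 + df (I01_1 R) * (t - 1).
Proof. by move=> t1; rewrite /extend ltNge (le_trans ler01 (ltW t1)) /= t1. Qed.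

Lemma c1diff_extend : c1diff extend.
Proof.
have [ex cdf] := ef.
have v0 : I01_val (I01_0 R) = 0 by []. have v1 : I01_val (I01_1 R) = 1 by [].
have p0 t : t <= 0 -> proj01 t = I01_0 R.
  by move=> t0; apply: I01_val_inj; rewrite proj01_val clamp_le0.
have p1 t : 1 <= t -> proj01 t = I01_1 R.
  by move=> t1; apply: I01_val_inj; rewrite proj01_val clamp_ge1.
have E0 : extend 0 = 0 by rewrite -{1}v0 extend01 homeo_I01_0.
have E1 : extend 1 = 1 by rewrite -{1}v1 extend01 homeo_I01_1.
have isd t : is_derive t 1 extend (df (proj01 t)).
  apply/is_derive_expands => e e0.
  have [t0|t0] := ltP t 0.
    exists (- t) => [|s st]; first by rewrite oppr_gt0.
    have s0 : s < 0 by move: st; rewrite ltr_norml; lra.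
    rewrite p0 ?(ltW t0) // !extend_lt0 // -mulrBr subrr normr0.
    by rewrite mulr_ge0 // ltW.
  have [t1|t1] := ltP 1 t.
    exists (t - 1) => [|s st]; first by rewrite subr_gt0.
    have s1 : 1 < s by move: st; rewrite ltr_norml; lra.
    rewrite p1 ?(ltW t1) // !extend_gt1 //.
    rewrite [X in `|X|](_ : _ = 0) ?normr0; last by lra.
    by rewrite mulr_ge0 // ltW.
  have t01 : 0 <= t <= 1 by rewrite t0.
  have [d d0 hd] := ex (proj01 t) e e0.
  (* Within distance d' of t, points outside [0, 1] occur only on the outer side
     of t = 0 or t = 1. *)
  pose d' := Num.min d (Num.min (if t == 0 then 1 else t) (if t == 1 then 1 else 1 - t)).
  exists d' => [|s].
    rewrite !lt_min d0 /=; apply/andP; split; case: eqP => // /eqP tn.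
      by rewrite lt_neqAle eq_sym tn.
    by rewrite subr_gt0 lt_neqAle tn.
  rewrite !lt_min => /and3P[sd st0 st1].
  have [s0|s0] := ltP s 0.
    have {st0} tE : t = 0.
      by move: st0; case: eqP => // _; rewrite ltr_norml; lra.
    rewrite tE E0 !subr0 p0 // extend_lt0 // subrr normr0.
    by rewrite mulr_ge0 // ltW.
  have [s1|s1] := ltP 1 s.
    have {st1} tE : t = 1.
      by move: st1; case: eqP => // _; rewrite ltr_norml; lra.
    rewrite tE E1 p1 // extend_gt1 //.
    rewrite [X in `|X|](_ : _ = 0) ?normr0; last by lra.
    by rewrite mulr_ge0 // ltW.
  have s01 : 0 <= s <= 1 by rewrite s0.
  have extE r : 0 <= r <= 1 -> extend r = I01_val (f (proj01 r)).
    by move=> r01; rewrite -extend01 val_proj01.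
  rewrite !extE //; have := hd (proj01 s); rewrite !val_proj01 //; exact.
apply: (proj1 (c1diff_of_is_derive isd _ _ E0 E1 _)) => [t|t|y].
- by apply: continuous_comp; [exact: continuous_proj01|exact: cdf].
- exact: df0.
- have [y0|y0] := ltP y 0.
    exists (y / df (I01_0 R)); rewrite extend_lt0 ?pmulr_llt0 ?invr_gt0 //.
    by rewrite mulrC divfK // gt_eqF.
  have [y1|y1] := ltP 1 y.
    exists (1 + (y - 1) / df (I01_1 R)).
    rewrite extend_gt1 ?ltrDl ?divr_gt0 ?subr_gt0 //.
    by rewrite [1 + _ - 1]addrAC subrr add0r mulrC divfK ?gt_eqF // subrKC.
  exists (I01_val (g (proj01 y))); rewrite extend01 gK val_proj01 //.
  by rewrite y0.
Qed.

End Extension.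

Lemma extend_commute (R : realType) (f1 f2 : I01 R -> I01 R)
    (df1 df2 : I01 R -> R) : (forall x, 0 < df1 x) -> (forall x, 0 < df2 x) ->
    (forall x, f1 (f2 x) = f2 (f1 x)) ->
  forall t, extend f1 df1 (extend f2 df2 t) = extend f2 df2 (extend f1 df1 t).
Proof.
move=> d1 d2 f12 t; have [t0|t0] := ltP t 0.
  rewrite [extend f2 _ t]extend_lt0 // [extend f1 _ t]extend_lt0 //.
  by rewrite !extend_lt0 ?pmulr_rlt0 //; lra.
have [t1|t1] := ltP 1 t.
  rewrite [extend f2 _ t]extend_gt1 // [extend f1 _ t]extend_gt1 //.
  rewrite !extend_gt1 ?ltrDl ?mulr_gt0 ?subr_gt0 //; lra.
have tE : t = I01_val (proj01 t) by rewrite val_proj01 // t0.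
by rewrite tE !extend01 f12.
Qed.

(** * Restriction to [0, 1] and the space of representations *)

Section Restriction.
Context {R : realType}.
Implicit Types (F : R -> R) (x : I01 R) (t e : R).

Definition restrict F x : I01 R := proj01 (F (I01_val x)).

Lemma restrict_val F x : c1diff F -> I01_val (restrict F x) = F (I01_val x).
Proof. by move=> cF; rewrite val_proj01 // c1_01 // I01_bounds. Qed.

Lemma restrict_comp F : c1diff F -> @I01_val R \o restrict F = F \o @I01_val R.
Proof. by move=> cF; apply/funext => x; exact: restrict_val. Qed.

Lemma expands_restrict F x : c1diff F ->
  expands (@I01_val R \o restrict F) x (der F (I01_val x)).
Proof.
move=> cF e e0; rewrite restrict_comp //.
have [_ /(_ (c1_is_derive (I01_val x) cF) e e0)[d d0 h]] :=
  is_derive_expands F (I01_val x) (der F (I01_val x)).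
by exists d => // y /h.
Qed.

Lemma deriv01_restrict F : c1diff F ->
  deriv01 (@I01_val R \o restrict F) = der F \o @I01_val R.
Proof.
by move=> cF; apply/funext => x; apply: (proj2 (expands_derivable01 (expands_restrict x cF))).
Qed.

Lemma class_C_restrict F : c1diff F -> class_C (Some 1%N) (@I01_val R \o restrict F).
Proof.
move=> cF; split=> [[|k]//= _ x|[|[|k]]//= _].
- exact: (proj1 (expands_derivable01 (expands_restrict x cF))).
- rewrite restrict_comp // => x.
  by apply: continuous_comp; [exact: continuous_I01_val|exact: c1_continuous].
- rewrite /derivn01 /= deriv01_restrict // => x.
  by apply: continuous_comp; [exact: continuous_I01_val|exact: c1_continuous_derive].
Qed.

Lemma restrict_diffeo F : c1diff F -> restrict F \in @diffeo_set R (Some 1%N).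
Proof.
move=> cF; rewrite inE /=; have [G FG GF] := c1_inverse cF.
have [cG _] := c1diff_inverse cF FG GF.
split; last by move=> x y xy; rewrite !restrict_val // c1_mono.
exists (restrict G); split; try exact: class_C_restrict.
- by move=> x; apply: I01_val_inj; rewrite !restrict_val // FG.
- by move=> x; apply: I01_val_inj; rewrite !restrict_val // GF.
Qed.

Definition diffeo_of F (cF : c1diff F) : Diffeo R (Some 1%N) :=
  SigSub (restrict_diffeo cF).

Lemma continuous_diffeo_of (u : R -> R -> R) (cu : forall t, c1diff (u t)) :
  (forall t, c1path_at u t) ->
  continuous (fun t : I01 R => diffeo_of (cu (I01_val t))).
Proof.
move=> pu; apply: continuous_comp_initial => t0.
apply/cvg_sup; first exact/fmap_filter/(nbhs_filter t0).
move=> k U [_ [[W oW <-] /= Wt0] WU].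
have : nbhs (jet (diffeo_of (cu (I01_val t0))) k) W by exact: open_nbhs_nbhs.
rewrite uniform_nbhs => -[E [entE EW]].
have [e /= e0 eE] := entE.
suff : \forall t \near t0, forall x,
    `|jet (diffeo_of (cu (I01_val t0))) k x - jet (diffeo_of (cu (I01_val t))) k x| < e.
  by apply: filterS => t h; apply: WU => /=; apply: EW => x _; apply: eE; exact: h.
have [cu0 cdu0] := pu (I01_val t0).
have unifI (h : R -> R -> R) : unif_at h (I01_val t0) ->
    \forall t \near t0, forall x,
      `|h (I01_val t0) (I01_val x) - h (I01_val t) (I01_val x)| < e.
  move=> uh.
  have H : \forall t \near t0, forall x : R, 0 <= x <= 1 ->
      `|h (I01_val t) x - h (I01_val t0) x| < e.
    exact: (@continuous_I01_val R t0 _ (uh e e0)).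
  by apply: filterS H => t ht x; rewrite distrC; apply: ht; exact: I01_bounds.
case: k {U W oW Wt0 WU E entE EW eE} => -[|[|k]] hk //.
- apply: filterS (unifI _ cu0) => t h x.
  have := h x; rewrite -(restrict_val x (cu (I01_val t0))).
  by rewrite -(restrict_val x (cu (I01_val t))).
- apply: filterS (unifI _ cdu0) => t h x.
  have e' s : der (u s) (I01_val x) = deriv01 (@I01_val R \o restrict (u s)) x.
    by rewrite deriv01_restrict.
  by have := h x; rewrite !e'.
Qed.

(** The two components of the family are indexed by true and false. *)
Lemma Reps_path (gamma : R -> bool -> R -> R) :
    (forall t, commuting (gamma t)) ->
    (forall b t0, c1path_at (fun t => gamma t b) t0) ->
  exists G : I01 R -> Reps R (Some 1%N), continuous G /\
    forall t : I01 R, Reps_maps (G t) =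
      (restrict (gamma (I01_val t) true), restrict (gamma (I01_val t) false)).
Proof.
move=> gc gp; have c1 b t : c1diff (gamma t b) by case: (gc t).
pose P (t : I01 R) := (diffeo_of (c1 true (I01_val t)), diffeo_of (c1 false (I01_val t))).
have Pc (t : I01 R) : P t \in @commuting_pairs R (Some 1%N).
  rewrite inE /commuting_pairs /=; apply/funext => x.
  pose F b := restrict (gamma (I01_val t) b).
  rewrite -[LHS]/(F true (F false x)) -[RHS]/(F false (F true x)).
  by apply: I01_val_inj; rewrite !restrict_val //; case: (gc (I01_val t)).
exists (fun t : I01 R => SigSub (Pc t)); split=> //.
apply: continuous_comp_initial => t0.
apply: (@cvg_pair _ _ _ _ (nbhs (P t0).1) (nbhs (P t0).2)).
- exact: (nbhs_filter t0).
- exact: (@continuous_diffeo_of (fun t => gamma t true) (c1 true) (gp true) t0).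
- exact: (@continuous_diffeo_of (fun t => gamma t false) (c1 false) (gp false) t0).
Qed.

Lemma Reps_extension r (rho : Reps R r) : order_le 1 r ->
  exists ext : bool -> R -> R, commuting ext /\
    (restrict (ext true), restrict (ext false)) = Reps_maps rho.
Proof.
move=> r1; case: rho => -[f1 f2] /= rc.
have fc : commuting_pairs (f1, f2) := set_mem rc.
have dif (f : Diffeo R r) : exists g (df : I01 R -> R),
    [/\ cancel (sval f) g, cancel g (sval f), c1expands (sval f) df,
       forall x, 0 < df x & {homo sval f : x y / I01_val x < I01_val y}].
  case: f => f /= fin; have [[g [fK gK cf cg]] hf] : diffeo_set r f.
    exact: set_mem fin.
  have ef := class_C_c1expands r1 cf; have eg := class_C_c1expands r1 cg.
  by exists g, (deriv01 (@I01_val R \o f)); split=> // x;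
    exact: (c1expands_gt0 x fK ef eg hf).
have [g1 [d1 [fK1 gK1 ef1 d10 hf1]]] := dif f1.
have [g2 [d2 [fK2 gK2 ef2 d20 hf2]]] := dif f2.
pose ext (b : bool) := if b then extend (sval f1) d1 else extend (sval f2) d2.
have f12 x : sval f1 (sval f2 x) = sval f2 (sval f1 x).
  exact: (congr1 (fun h => h x) fc).
have c1ext b : c1diff (ext b).
  by case: b; [exact: (c1diff_extend gK1)|exact: (c1diff_extend gK2)].
exists ext; split.
  split=> // -[] [] x //; rewrite /ext; last symmetry; exact: extend_commute.
rewrite /Reps_maps; congr pair; apply/funext => x; apply: I01_val_inj.
  by rewrite restrict_val //; exact: (extend01 (sval f1) d1 x).
by rewrite restrict_val //; exact: (extend01 (sval f2) d2 x).
Qed.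

End Restriction.

(** Both representations are joined to the trivial one. *)
Lemma Reps_joined (R : realType) (r : option nat) (rho rho' : Reps R r) :
    order_le 1 r ->
  exists gamma : I01 R -> Reps R (Some 1%N),
    continuous gamma /\
    Reps_maps (gamma (I01_0 R)) = Reps_maps rho /\
    Reps_maps (gamma (I01_1 R)) = Reps_maps rho'.
Proof.
move=> r1.
have [e1 [ce1 <-]] := Reps_extension rho r1.
have [e2 [ce2 <-]] := Reps_extension rho' r1.
have [g1 [g10 g11 gc1 gp1]] := path_to_identity ce1.
have [g2 [g20 g21 gc2 gp2]] := path_to_identity ce2.
pose gamma (t : R) := if t <= 1 / 2 then g1 (2 * t) else g2 (2 - 2 * t).
have [||G [cG GE]] := @Reps_path R gamma.
- by move=> t; rewrite /gamma; case: ifP.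
- move=> b t0; pose u1 t := g1 (2 * t) b; pose u2 t := g2 (2 - 2 * t) b.
  rewrite (_ : (fun _ => _) = (fun t => if t <= 1 / 2 then u1 t else u2 t)); last first.
    by apply/funext => t; rewrite /gamma; case: ifP.
  apply: c1path_at_glue => [_|_|]; rewrite /u1 /u2.
  + apply: (@c1path_at_comp _ (g1 ^~ b) (fun t => 2 * t)) => //.
    by apply: cvgM; [exact: cvg_cst|exact: cvg_id].
  + apply: (@c1path_at_comp _ (g2 ^~ b) (fun t => 2 - 2 * t)) => //.
    apply: cvgB; first exact: cvg_cst.
    by apply: cvgM; [exact: cvg_cst|exact: cvg_id].
  + by rewrite g11 ?g21 //; lra.
exists G; split=> //; rewrite !GE /gamma; split.
  by rewrite ifT ?g10 //= ?mulr0 //; rewrite -[I01_val _]/(0 : R); lra.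
by rewrite ifF ?g20 //; rewrite -[I01_val _]/(1 : R); lra.
Qed.

Local Close Scope ring_scope.
Local Close Scope classical_set_scope.

Theorem theoremA (R : realType) (r : option nat) (hr : order_le 2 r)
    (rho rho' : Reps R r) :
  exists gamma : I01 R -> Reps R (Some 1),
    continuous gamma /\
    Reps_maps (gamma (I01_0 R)) = Reps_maps rho /\
    Reps_maps (gamma (I01_1 R)) = Reps_maps rho'.
Proof.
by apply: Reps_joined; case: r hr {rho rho'} => //= n; exact: ltnW.
Qed.
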